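(* Let $P=\{p_1,\dots,p_n\}$ be a finite set, let $r\ge 2$, and let $\mathcal{F}=\{\leq_{[a,b]}: 1\le a\le b\le r-1\}$ be a family of reflexive and antisymmetric relations on $P$ with the following properties: (i) for every $a\in[r-1]$, the relation $\leq_a\,:=\,\leq_{[a,a]}$ is a partial order on $P$; (ii) for $1\le a\le b\le r-1$, if $p_i\leq_{[a,b]}p_j$, then $i\le j$; (iii) for $1\le a\le b\le r-1$, $p_i\leq_{[a,b]}p_j$ if and only if there exists a non-decreasing sequence $(t_1,t_2,\dots,t_k)$ of elements of $[n]$, with $k=b-a$, such that $p_i\leq_a p_{t_1}\leq_{a+1}\cdots\leq_{b-1}p_{t_k}\leq_b p_j$ (for $a=b$ this reads $p_i\leq_a p_j$). Then the $r$-partite graph associated to $\mathcal{F}$ is Cohen-Macaulay.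
   Context: $[m]=\{1,\dots,m\}$. The $r$-partite graph associated to $\mathcal{F}$ has vertex set $V=\bigcup_{a=1}^r V_a$ (disjoint union) with $V_a=\{X_{a,1},\dots,X_{a,n}\}$; no two vertices in the same $V_a$ are adjacent, and for $1\le a<b\le r$ and $i,j\in[n]$, $X_{a,i}$ is adjacent to $X_{b,j}$ if and only if $p_i\leq_{[a,b-1]}p_j$. Let ${\sf k}$ be a field and $S={\sf k}[X_{a,i}:a\in[r],i\in[n]]$. The edge ideal of a graph $G$ on $V$ is $I(G)=\langle xy:\{x,y\}\text{ an edge of }G\rangle\subset S$. $G$ is called Cohen-Macaulay if $S/I(G)$ is a Cohen-Macaulay ring. *)

(* Defs.v *)
From HB Require Import structures.
From mathcomp Require Import all_boot all_order all_algebra.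
From mathcomp Require Import boolp.
From mathcomp Require Import ring.

Set Implicit Arguments.
Unset Strict Implicit.
Unset Printing Implicit Defensive.

Import GRing.Theory.
Local Open Scope ring_scope.
Local Open Scope quotient_scope.

(* In ring_quotient, [idealr R] is the type of proper ideals of R and
   [prime_idealr R] the type of (proper) prime ideals. *)

Section GeneratedIdeal.
Variables (R : comNzRingType) (G : {pred R}).

Definition gen_ideal : {pred R} :=
  [pred x | `[< exists2 s : seq (R * R),
                  all (fun c => c.2 \in G) s & x = \sum_(c <- s) c.1 * c.2 >]].

Lemma gen_ideal_closed : 1 \notin gen_ideal -> idealr_closed gen_ideal.
Proof.
move=> h1; split=> //; first by apply/asboolP; exists [::]; rewrite ?big_nil.
move=> a _ _ /asboolP[s Gs ->] /asboolP[t Gt ->]; apply/asboolP.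
exists ([seq (a * c.1, c.2) | c <- s] ++ t).
  by rewrite all_cat all_map Gt andbT.
rewrite big_cat big_map mulr_sumr; congr (_ + _).
by apply: eq_bigr => c _; rewrite mulrA.
Qed.

End GeneratedIdeal.

Section RingNotions.
Variable R : comNzRingType.

(* Only proper ideals are considered; the unit ideal is generated by 1. *)
Definition noetherian : Prop :=
  forall I : idealr R, exists s : seq R, I =i gen_ideal [in s].

Definition maximal_ideal (M : {pred R}) : Prop :=
  forall J : idealr R, {subset M <= J} -> {subset J <= M}.

Definition prime_chain (c : nat -> prime_idealr R) (d : nat) : Prop :=
  forall i, (i < d)%N -> {subset c i <= c i.+1} /\ ~ {subset c i.+1 <= c i}.

Definition has_krull_dim (d : nat) : Prop :=
  (exists c, prime_chain c d) /\
  (forall c d', prime_chain c d' -> (d' <= d)%N).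

Definition regular_seq (s : seq R) : Prop :=
  (forall i, (i < size s)%N -> forall a,
     s`_i * a \in gen_ideal [in take i s] -> a \in gen_ideal [in take i s]) /\
  1 \notin gen_ideal [in s].

(* The maximal ideal, when R is local. *)
Definition nonunits : {pred R} := [pred x | `[< ~ exists y, y * x = 1 >]].

Definition has_local_depth (d : nat) : Prop :=
  (exists s, [/\ regular_seq s, all [in nonunits] s & size s = d]) /\
  (forall s, regular_seq s -> all [in nonunits] s -> (size s <= d)%N).

(* Intended for noetherian local R. *)
Definition CohenMacaulay_local : Prop :=
  exists d, has_local_depth d /\ has_krull_dim d.

End RingNotions.

Module Localization.
Section Localization.
Variables (R : comNzRingType) (p : prime_idealr R).

Definition frac := {x : R * R | x.2 \notin p}.
HB.instance Definition _ := Choice.on frac.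

Implicit Types x y z : frac.
Local Notation "'\n_' x" := (val x).1 (at level 8, x at level 2).
Local Notation "'\d_' x" := (val x).2 (at level 8, x at level 2).

Lemma denP x : \d_x \notin p. Proof. exact: (valP x). Qed.

Lemma notin1 : 1 \notin p. Proof. by rewrite idealr1. Qed.

Lemma notinM u v : u \notin p -> v \notin p -> u * v \notin p.
Proof. by move=> hu hv; rewrite prime_idealrM negb_or hu. Qed.

Definition mk (a b : R) (hb : b \notin p) : frac :=
  exist (fun x : R * R => x.2 \notin p) (a, b) hb.

(* R need not be a domain, whence the factor u. *)
Definition equiv x y : bool :=
  `[< exists2 u, u \notin p & u * (\n_x * \d_y) = u * (\n_y * \d_x) >].

Lemma equiv_refl : reflexive equiv.
Proof. by move=> x; apply/asboolP; exists 1; rewrite ?notin1. Qed.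

Lemma equiv_sym : symmetric equiv.
Proof. by move=> x y; apply/asboolP/asboolP => -[u hu e]; exists u. Qed.

Lemma equiv_trans : transitive equiv.
Proof.
move=> y x z /asboolP[u hu e] /asboolP[v hv f]; apply/asboolP.
exists (u * v * \d_y); first by rewrite !notinM // denP.
transitivity (v * \d_z * (u * (\n_x * \d_y))); first by ring.
rewrite e; transitivity (u * \d_x * (v * (\n_y * \d_z))); first by ring.
by rewrite f; ring.
Qed.

Canonical equiv_equiv := EquivRel equiv equiv_refl equiv_sym equiv_trans.

Definition type := {eq_quot equiv}.
HB.instance Definition _ : EqQuotient _ equiv type := EqQuotient.on type.
HB.instance Definition _ := Choice.on type.

Lemma equivP x y :
  reflect (exists2 u, u \notin p & u * (\n_x * \d_y) = u * (\n_y * \d_x))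
          (x == y %[mod type]).
Proof. by rewrite eqmodE; apply: asboolP. Qed.

Lemma reprP x : exists2 u, u \notin p &
  u * (\n_(repr (\pi_type x)) * \d_x) = u * (\n_x * \d_(repr (\pi_type x))).
Proof. by apply/equivP; rewrite reprK. Qed.

Definition zerof : frac := mk 0 notin1.
Definition onef : frac := mk 1 notin1.
Definition oppf x : frac := mk (- \n_x) (denP x).
Definition addf x y : frac :=
  mk (\n_x * \d_y + \n_y * \d_x) (notinM (denP x) (denP y)).
Definition mulf x y : frac := mk (\n_x * \n_y) (notinM (denP x) (denP y)).

Definition zero := lift_cst type zerof.
Canonical pi_zero_morph := PiConst zero.
Definition one := lift_cst type onef.
Canonical pi_one_morph := PiConst one.
Definition opp := lift_op1 type oppf.
Definition add := lift_op2 type addf.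
Definition mul := lift_op2 type mulf.

Lemma pi_opp : {morph \pi : x / oppf x >-> opp x}.
Proof.
move=> x; unlock opp; apply/eqP/equivP => /=.
by have [u hu e] := reprP x; exists u => //; rewrite !mulNr !mulrN e.
Qed.
Canonical pi_opp_morph := PiMorph1 pi_opp.

Lemma pi_add : {morph \pi : x y / addf x y >-> add x y}.
Proof.
move=> x y; unlock add; apply/eqP/equivP => /=.
have [u hu e] := reprP x; have [v hv f] := reprP y.
set x' := repr (\pi x) in e *; set y' := repr (\pi y) in f *.
exists (u * v); first exact: notinM.
transitivity (v * (\d_y * \d_y') * (u * (\n_x * \d_x')) +
              u * (\d_x * \d_x') * (v * (\n_y * \d_y'))); first by ring.
by rewrite -f -e; ring.
Qed.
Canonical pi_add_morph := PiMorph2 pi_add.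

Lemma pi_mul : {morph \pi : x y / mulf x y >-> mul x y}.
Proof.
move=> x y; unlock mul; apply/eqP/equivP => /=.
have [u hu e] := reprP x; have [v hv f] := reprP y.
set x' := repr (\pi x) in e *; set y' := repr (\pi y) in f *.
exists (u * v); first exact: notinM.
transitivity ((u * (\n_x * \d_x')) * (v * (\n_y * \d_y'))); first by ring.
by rewrite -f -e; ring.
Qed.
Canonical pi_mul_morph := PiMorph2 pi_mul.

Lemma eq_pi x y : \n_x * \d_y = \n_y * \d_x -> \pi_type x = \pi_type y.
Proof. by move=> e; apply/eqP/equivP; exists 1; rewrite ?notin1 // e. Qed.

Lemma addA : associative add.
Proof.
elim/quotW=> x; elim/quotW=> y; elim/quotW=> z.
by rewrite !piE; apply: eq_pi => /=; ring.
Qed.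

Lemma addC : commutative add.
Proof.
by elim/quotW=> x; elim/quotW=> y; rewrite !piE; apply: eq_pi => /=; ring.
Qed.

Lemma add0 : left_id zero add.
Proof. by elim/quotW=> x; rewrite !piE; apply: eq_pi => /=; ring. Qed.

Lemma addN : left_inverse zero opp add.
Proof. by elim/quotW=> x; rewrite !piE; apply: eq_pi => /=; ring. Qed.

HB.instance Definition _ := GRing.isZmodule.Build type addA addC add0 addN.

Lemma mulA : associative mul.
Proof.
elim/quotW=> x; elim/quotW=> y; elim/quotW=> z.
by rewrite !piE; apply: eq_pi => /=; ring.
Qed.

Lemma mulC : commutative mul.
Proof.
by elim/quotW=> x; elim/quotW=> y; rewrite !piE; apply: eq_pi => /=; ring.
Qed.

Lemma mul1 : left_id one mul.
Proof. by elim/quotW=> x; rewrite !piE; apply: eq_pi => /=; ring. Qed.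

Lemma mul_addl : left_distributive mul add.
Proof.
elim/quotW=> x; elim/quotW=> y; elim/quotW=> z.
by rewrite !piE; apply: eq_pi => /=; ring.
Qed.

Lemma nonzero1 : one != zero.
Proof.
rewrite /one /zero -!lock; apply/equivP => -[u hu] /=.
by rewrite !(mulr1, mul0r, mulr0) => u0; rewrite u0 idealr0 in hu.
Qed.

HB.instance Definition _ :=
  GRing.Zmodule_isComNzRing.Build type mulA mulC mul1 mul_addl nonzero1.

End Localization.
End Localization.
HB.export Localization.

Definition localization (R : comNzRingType) (p : prime_idealr R) : comNzRingType :=
  Localization.type p.

(* Maximal ideals are prime, so p ranges over all maximal ideals of R. *)
Definition CohenMacaulay (R : comNzRingType) : Prop :=
  noetherian R /\
  forall p : prime_idealr R, maximal_ideal p ->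
    CohenMacaulay_local (localization p).

Record simple_graph (V : finType) := SimpleGraph {
  adj :> rel V;
  adj_sym : symmetric adj;
  adj_irr : irreflexive adj
}.

(* [le a b] is the relation written <=_[a,b], with a and b counted from 1.
   Indices of parts and of elements of P are counted from 0 in the vertex set
   'I_r * 'I_n: the vertex (a, i) stands for X_{a+1,i+1}. *)
Section RPartiteGraph.
Variables (r n : nat) (P : finType) (p : 'I_n -> P) (le : nat -> nat -> rel P).

Definition rpartite_adj : rel ('I_r * 'I_n) := fun x y =>
  ((x.1 < y.1)%N && le x.1.+1 y.1 (p x.2) (p y.2)) ||
  ((y.1 < x.1)%N && le y.1.+1 x.1 (p y.2) (p x.2)).

Lemma rpartite_adj_sym : symmetric rpartite_adj.
Proof. by move=> x y; rewrite /rpartite_adj orbC. Qed.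

Lemma rpartite_adj_irr : irreflexive rpartite_adj.
Proof. by move=> x; rewrite /rpartite_adj ltnn. Qed.

Definition rpartite_graph : simple_graph ('I_r * 'I_n)%type :=
  SimpleGraph rpartite_adj_sym rpartite_adj_irr.

(* p_i <=_a p_{t_1} <=_{a+1} ... p_{t_k} <=_{a+k} p_j, where k = size t *)
Definition le_chain (a : nat) (i : 'I_n) (t : seq 'I_n) (j : 'I_n) : Prop :=
  let s := i :: rcons t j in
  forall l, (l <= size t)%N ->
    le (a + l) (a + l) (p (nth i s l)) (p (nth i s l.+1)).

End RPartiteGraph.

(* Imported last: this file redefines [symmetric]. *)
From mathcomp Require Import mpoly.

Section EdgeIdeal.
Variables (k : fieldType) (V : finType) (G : simple_graph V).

Definition vpoly : comNzRingType := {mpoly k[#|V|]}.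

Definition var (v : V) : vpoly := 'X_(enum_rank v).

Definition edge_ideal : {pred vpoly} :=
  gen_ideal [pred q : vpoly |
    [exists x, exists y, G x y && (q == var x * var y)]].

Lemma edge_ideal_proper : 1 \notin edge_ideal.
Proof.
apply/asboolP => -[s /allP sG]; move/(congr1 (meval (fun=> 0))).
rewrite meval1 raddf_sum big_seq big1 => [/eqP|c /sG]; first by rewrite oner_eq0.
case/existsP => x /existsP[y /andP[_ /eqP ->]].
by rewrite /= !mevalM !mevalXU !mulr0.
Qed.

HB.instance Definition _ :=
  isIdealr.Build vpoly edge_ideal (gen_ideal_closed edge_ideal_proper).

Definition edge_ring : comNzRingType := {ideal_quot edge_ideal}.

Definition CohenMacaulay_graph : Prop := CohenMacaulay edge_ring.

End EdgeIdeal.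

(* Main.v *)
From HB Require Import structures.
From mathcomp Require Import all_boot all_algebra.
From mathcomp Require Import boolp.
From mathcomp Require classical_sets.
From mathcomp Require Import mpoly.
From mathcomp Require Import ring zify.
Require Import Defs.

Set Implicit Arguments.
Unset Strict Implicit.
Unset Printing Implicit Defensive.

Import GRing.Theory.
Local Open Scope ring_scope.
Local Open Scope quotient_scope.

(** Write [S] for the polynomial ring, [I] for the edge ideal, [A = S/I], and
    colour the vertex [(a, i)] by [i].  Reflexivity of the relations makes each
    colour class a clique, so there are [n] classes, an independent set has at
    most one vertex in each, and every local ring of [A] at a maximal ideal
    should have dimension and depth [n].

    Upper bound on the dimension ([krull_bound]).  A prime of [A] contains all
    but at most one variable of each colour, hence modulo the bottom of a chain
    of primes [P_0 < ... < P_d] every element is a polynomial in [n] elements.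
    If [d > n], elements [x_i] of [P_(i+1)] outside [P_i], for [i <= n], satisfy
    a polynomial relation ([algebraic_dependence]).  Factoring out the least
    power of [x_0], then reducing modulo [x_0], which lies in [P_1], and so on,
    puts a nonzero constant in a prime ([prime_chain_no_relation]).

    Lower bound on the depth.  Let [theta_i] be the sum of the variables of
    colour [i], and [m] a maximal ideal of [A].  By Zariski's lemma
    ([zariski]), [theta_i] is algebraic over [k] modulo [m], so a monic
    polynomial [f_i] has [f_i(theta_i)] in [m].  The heart of the matter is that
    [f_1(theta_1), ..., f_n(theta_n)] is a regular sequence on [A], whatever
    the monic [f_i] are ([sheddable_regular]).  For the ideal [J_W] of the
    complex of independent sets contained in [W], one has
    [J_W : x_v = J_(W - N(v))] and [J_W + (x_v) = J_(W - v)], and regularity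
    passes from these two ideals to [J_W] ([weakly_regular_colon]).  This
    reduces to the case where [W] is an independent set with one vertex [w_i] of
    each colour; then the quotient is a polynomial ring in the [x_(w_i)] and
    the sequence is [f_i(x_(w_i))], one monic polynomial per variable.

    Depth and dimension meet because a regular sequence in any ring produces a
    chain of primes of the same length ([regular_seq_chain]): the regular
    sequence of length [n] gives dimension at least [n], and no regular sequence
    is longer than [n].

    The combinatorial input is an order of removal of the vertices
    ([window_sheddable]).  Orient edges from the lower to the higher part.  At
    each stage the surviving vertices of colour [i] occupy an interval of parts
    [lo i .. hi i] whose bottom vertex has no surviving in-neighbour.  The vertex
    removed is the top [(hi i, i)] of the last colour [i] that has more than one
    survivor.  Passing to its non-neighbours only raises the bottoms of the
    intervals, and the new bottoms again have no in-neighbours because the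
    relations [<=_a] are transitive.  Finally [A] is noetherian by Hilbert's
    basis theorem ([hilbert_basis]). *)

(** * Regular sequences and chains of primes *)

Section Ideals.
Variable R : comNzRingType.
Implicit Types (I J : R -> Prop) (s : seq R).

Definition is_ideal I :=
  [/\ I 0, forall x y, I x -> I y -> I (x + y) & forall a x, I x -> I (a * x)].

Definition adjoin_ideal J f : R -> Prop := fun x => exists c, J (x - c * f).

Definition colon J x : R -> Prop := fun a => J (x * a).

(** The ideal [J + (s)]. *)
Fixpoint gens J s : R -> Prop :=
  if s is f :: s' then gens (adjoin_ideal J f) s' else J.

(** Nonzerodivisor on [R/J]. *)
Definition nzd J f := forall a, J (f * a) -> J a.

(** Regularity of [s] on [R/J], except that [J + (s)] may be the unit ideal:
    this form is the one inherited from [J : x] and [J + (x)]. *)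
Fixpoint weakly_regular J s : Prop :=
  if s is f :: s' then nzd J f /\ weakly_regular (adjoin_ideal J f) s'
  else True.

Lemma idealB J : is_ideal J -> forall x y, J x -> J y -> J (x - y).
Proof. by case=> J0 JD JM x y Jx Jy; rewrite -mulN1r; apply: JD => //; exact: JM. Qed.

Lemma idealN J : is_ideal J -> forall x, J x -> J (- x).
Proof. by case=> J0 JD JM x Jx; rewrite -mulN1r; exact: JM. Qed.

Lemma ideal_sum J (T : Type) (r : seq T) (P : pred T) (F : T -> R) :
  is_ideal J -> (forall i, P i -> J (F i)) -> J (\sum_(i <- r | P i) F i).
Proof. by case=> J0 JD _ h; apply: big_ind. Qed.

Lemma ideal_zero : is_ideal (fun x => x = 0).
Proof. by split=> [//|x y -> ->|a x ->]; rewrite ?addr0 ?mulr0. Qed.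

Lemma adjoin_is_ideal J f : is_ideal J -> is_ideal (adjoin_ideal J f).
Proof.
case=> J0 JD JM; split.
- by exists 0; rewrite mul0r subr0.
- move=> x y [c hc] [d hd]; exists (c + d).
  by have := JD _ _ hc hd; congr J; ring.
- by move=> a x [c hc]; exists (a * c); have := JM a _ hc; congr J; ring.
Qed.

Lemma sub_adjoin J f x : J x -> adjoin_ideal J f x.
Proof. by move=> Jx; exists 0; rewrite mul0r subr0. Qed.

Lemma mem_adjoin J f : is_ideal J -> adjoin_ideal J f f.
Proof. by case=> J0 _ _; exists 1; rewrite mul1r subrr. Qed.

Lemma gens_is_ideal J s : is_ideal J -> is_ideal (gens J s).
Proof. by elim: s J => //= f s IH J iJ; apply/IH/adjoin_is_ideal. Qed.

Lemma sub_gens J s x : J x -> gens J s x.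
Proof. by elim: s J => //= f s IH J Jx; apply/IH/sub_adjoin. Qed.

Lemma mem_gens J s f : is_ideal J -> f \in s -> gens J s f.
Proof.
elim: s J => //= g s IH J iJ; rewrite inE => /predU1P[->|fs].
  by apply: sub_gens; exact: mem_adjoin.
by apply: IH => //; exact: adjoin_is_ideal.
Qed.

Lemma gens_min J K s : is_ideal K -> (forall x, J x -> K x) ->
  {in s, forall x, K x} -> forall x, gens J s x -> K x.
Proof.
move=> iK; have [_ KD KM] := iK.
elim: s J => //= f s IH J JK sK; apply: IH => [x [c /JK hc]|x xs].
  by rewrite -(subrK (c * f) x); apply/KD/KM/sK; rewrite ?mem_head.
by apply: sK; rewrite inE xs orbT.
Qed.

Lemma gen_idealP (G : {pred R}) :
  [/\ is_ideal (fun x => x \in gen_ideal G), {in G, forall x, x \in gen_ideal G} &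
   forall K, is_ideal K -> {in G, forall x, K x} -> {in gen_ideal G, forall x, K x}].
Proof.
split.
- split.
  + by apply/asboolP; exists [::]; rewrite ?big_nil.
  + move=> x y /asboolP[s hs ->] /asboolP[t ht ->]; apply/asboolP.
    by exists (s ++ t); rewrite ?all_cat ?hs // big_cat.
  + move=> a x /asboolP[s hs ->]; apply/asboolP.
    exists [seq (a * c.1, c.2) | c <- s]; first by rewrite all_map.
    by rewrite big_map mulr_sumr; apply: eq_bigr => c _; rewrite mulrA.
- move=> x Gx; apply/asboolP; exists [:: (1, x)]; first by rewrite /= Gx.
  by rewrite big_seq1 mul1r.
- move=> K iK GK x /asboolP[s /allP hs ->]; have [_ _ KM] := iK; rewrite big_seq.
  by apply: (ideal_sum _ iK) => c cs; apply: KM; apply: GK; exact: hs.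
Qed.

Lemma gen_ideal_gens s x : x \in gen_ideal (mem s) <-> gens (fun x => x = 0) s x.
Proof.
have [iG sG minG] := gen_idealP (mem s); split.
  apply: (minG _ (gens_is_ideal s ideal_zero)) => y ys.
  exact: mem_gens ideal_zero ys.
by apply: (gens_min iG) => // _ ->; case: iG.
Qed.

Lemma weakly_regularP J s : weakly_regular J s <->
  forall i, (i < size s)%N -> nzd (gens J (take i s)) s`_i.
Proof.
elim: s J => [|f s IH] J /=; first by split.
split=> [[hf /IH hs] [|i] //= lti|h]; first exact: hs.
by split; [exact: (h 0%N)|apply/IH => i lti; exact: (h i.+1)].
Qed.

Lemma regular_seqP s :
  regular_seq s <-> weakly_regular (fun x => x = 0) s /\ ~ gens (fun x => x = 0) s 1.
Proof.
rewrite /regular_seq; split=> -[h1 h2]; split.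
- apply/weakly_regularP => i lti a /gen_ideal_gens hi.
  exact/gen_ideal_gens/h1.
- by move/gen_ideal_gens; apply/negP.
- move=> i lti a /gen_ideal_gens hi; apply/gen_ideal_gens.
  by move/weakly_regularP: h1 => /(_ i lti); apply.
- by apply/negP => /gen_ideal_gens.
Qed.

(** Injectivity of [R/(J : x) -> R/J], multiplication by [x], is preserved modulo
    [f], because [f] is regular on the cokernel [R/(J + (x))]. *)
Lemma colon_adjoin J f x : is_ideal J -> nzd (adjoin_ideal J x) f ->
  colon (adjoin_ideal J f) x = adjoin_ideal (colon J x) f.
Proof.
move=> iJ fx; have [J0 JD JM] := iJ.
apply/funext => b; apply/propext; split=> -[c hc].
- have [d hd] : adjoin_ideal J x c.
    apply: fx; exists b; rewrite -opprB.
    by have := idealN iJ hc; congr J; ring.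
  exists d; rewrite /colon.
  by have := JD _ _ hc (JM f _ hd); congr J; ring.
- by exists (x * c); move: hc; rewrite /colon; congr J; ring.
Qed.

Lemma adjoinC J f g : adjoin_ideal (adjoin_ideal J f) g =
  adjoin_ideal (adjoin_ideal J g) f.
Proof.
have h f' g' x : adjoin_ideal (adjoin_ideal J f') g' x ->
    adjoin_ideal (adjoin_ideal J g') f' x.
  by case=> c [d hd]; exists d, c; move: hd; congr J; ring.
by apply/funext => x; apply/propext; split; exact: h.
Qed.

(** Multiplication by [x] gives an exact sequence
    [0 -> R/(J : x) -> R/J -> R/(J + (x)) -> 0]; a sequence regular on both ends
    is regular in the middle, one element at a time. *)
Lemma weakly_regular_colon J x s : is_ideal J ->
  weakly_regular (colon J x) s -> weakly_regular (adjoin_ideal J x) s ->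
  weakly_regular J s.
Proof.
elim: s J => //= f s IH J iJ [fc sc] [fa sa]; have [J0 JD JM] := iJ.
split=> [a fJ|].
  have [b hb] : adjoin_ideal J x a by apply/fa/sub_adjoin.
  have /fc xbJ : colon J x (f * b).
    by have := idealB iJ fJ (JM f _ hb); congr J; ring.
  by have := JD _ _ hb xbJ; congr J; ring.
apply: IH; first exact: adjoin_is_ideal.
  by rewrite colon_adjoin.
by rewrite adjoinC.
Qed.

(** An ideal maximal among those that contain [J] and avoid the multiplicative
    set [M] is prime. *)
Lemma krull_prime J (M : R -> Prop) : is_ideal J ->
  M 1 -> (forall x y, M x -> M y -> M (x * y)) -> (forall x, J x -> ~ M x) ->
  exists Q : prime_idealr R, (forall x, J x -> x \in Q) /\ (forall x, M x -> x \notin Q).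
Proof.
move=> iJ M1 MM JM.
pose good (I : R -> Prop) := is_ideal I /\ forall x, I x -> ~ M x.
(* Zorn's lemma is applied to sets [A] such that [A] union [J] is good, so that
   the empty chain is bounded as well. *)
pose u (I : classical_sets.set R) : R -> Prop := fun x => I x \/ J x.
have [|A [gA maxA]] := @classical_sets.Zorn_bigcup R (fun I => good (u I)).
  move=> F FP Ftot; split; last first.
    by move=> x [[X FX Xx]|/JM//]; apply: (FP _ FX).2; left.
  have sub X : F X -> forall x, u X x ->
      u (classical_sets.bigcup F (fun X => X)) x.
    by move=> FX x [Xx|Jx]; [left; exists X|right].
  have [[X0 FX0]|nF] := pselect (exists X, F X); last first.
    have -> : u (classical_sets.bigcup F (fun X => X)) = J.
      apply/funext => x; apply/propext; split=> [[[X FX _]|//]|Jx].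
        by case: nF; exists X.
      by right.
    by [].
  split.
  - by right; case: iJ.
  - move=> x y ux uy.
    have {ux}[X FX Xx] : exists2 X, F X & u X x.
      by case: ux => [[X FX Xx]|Jx]; [exists X => //; left|exists X0 => //; right].
    have {uy}[Y FY Yy] : exists2 X, F X & u X y.
      by case: uy => [[Y FY Yy]|Jy]; [exists Y => //; left|exists X0 => //; right].
    have [Z [FZ Zx Zy]] : exists Z, [/\ F Z, u Z x & u Z y].
      have [XY|YX] := Ftot _ _ FX FY.
        by exists Y; split=> //; case: Xx => [/XY|]; [left|right].
      by exists X; split=> //; case: Yy => [/YX|]; [left|right].
    apply: (sub Z FZ).
    by case: (FP _ FZ).1 => _ + _; apply.
  - move=> a x [[X FX Xx]|Jx].
      by apply: (sub X FX); case: (FP _ FX).1 => _ _; apply; left.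
    by right; case: iJ => _ _; apply.
pose I := u A; have [iI IM] : good I := gA; have [I0 ID IMl] := iI.
have maxI f : ~ I f -> exists a, M a /\ adjoin_ideal I f a.
  move=> nIf; apply: contrapT => h.
  have eB : u (adjoin_ideal I f) = adjoin_ideal I f.
    apply/funext => x; apply/propext; split=> [[//|Jx]|]; last by left.
    by apply: sub_adjoin; right.
  apply: (maxA (adjoin_ideal I f)).
    split=> [x Ax|AI]; first by apply: sub_adjoin; left.
    by apply: nIf; left; apply: AI; exact: mem_adjoin.
  rewrite eB; split; first exact: adjoin_is_ideal.
  by move=> x hx Mx; apply: h; exists x.
pose Q : {pred R} := fun x => `[< I x >].
have Qclosed : idealr_closed Q.
  split; first exact/asboolP.
    by apply/asboolP => /IM; apply.
  by move=> a x y /asboolP hx /asboolP hy; apply/asboolP/ID => //; exact: IMl.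
have Qprime : prime_idealr_closed Q.
  move=> x y /asboolP Ixy; apply/idP; apply: contraT.
  rewrite negb_or => /andP[/asboolP nx /asboolP ny].
  have [a [Ma [c hc]]] := maxI _ nx; have [b [Mb [d hd]]] := maxI _ ny.
  case: (IM (a * b)); last exact: MM.
  have -> : a * b = b * (a - c * x) + c * x * (b - d * y) + (c * d) * (x * y).
    by ring.
  by apply: (ID _ _ _ (IMl _ _ Ixy)); apply: ID; exact: IMl.
pose Qi := isIdealr.Build R Q Qclosed.
pose Qp := isPrimeIdealrClosed.Build R Q Qprime.
pose P : prime_idealr R := HB.pack Q Qi Qp.
exists P; split=> x hx; first by apply/asboolP; right.
by apply/asboolP => /IM; apply.
Qed.

(** Going down one step: given a prime [c 0] over [J + (f)] with [f] regular on
    [R/J], the set of products [f ^+ k * t] with [t] outside [c 0] avoids [J], so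
    some prime over [J] lies in [c 0] and misses [f]. *)
Lemma weakly_regular_chain J s (Q : prime_idealr R) : is_ideal J ->
  weakly_regular J s -> (forall x, gens J s x -> x \in Q) ->
  exists2 c, prime_chain c (size s) & forall x, J x -> x \in c 0%N.
Proof.
elim: s J => [|f s IH] J iJ /=; first by move=> _ JQ; exists (fun=> Q).
case=> fnzd sreg sQ.
have [c chain_c Jc] := IH _ (adjoin_is_ideal f iJ) sreg sQ.
pose M x := exists k, exists2 t, t \notin c 0%N & x = f ^+ k * t.
have [| | |P [JP MP]] := @krull_prime J M iJ.
- by exists 0%N, 1; rewrite ?idealr1 // mulr1.
- move=> _ _ [k [t ht ->]] [l [u hu ->]]; exists (k + l)%N, (t * u).
    by rewrite prime_idealrM negb_or ht.
  by rewrite exprD; ring.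
- move=> x Jx [k [t ht ex]]; rewrite {x}ex in Jx; case/negP: ht.
  apply/Jc/sub_adjoin; elim: k Jx => [|k IHk]; first by rewrite mul1r.
  by rewrite exprS -mulrA => /fnzd.
exists (fun i => if i is i'.+1 then c i' else P) => //.
move=> [|i] lti; last exact: chain_c.
split=> [x xP|sub].
  apply: contraLR xP => xc; apply: MP; exists 0%N, x => //.
  by rewrite mul1r.
have fP : f \notin P by apply: MP; exists 1%N, 1; rewrite ?idealr1 // expr1 mulr1.
by case/negP: fP; apply: sub; apply: Jc; exact: mem_adjoin.
Qed.

Lemma regular_seq_chain s : regular_seq s -> exists c : nat -> prime_idealr R, prime_chain c (size s).
Proof.
move/regular_seqP => [sreg s1].
have iG := gens_is_ideal s ideal_zero; have [_ GD GM] := iG.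
have [| | |Q [GQ _]] := @krull_prime _ (fun x => x = 1) iG; rewrite ?mulr1 //.
- by move=> x y -> ->; rewrite mulr1.
- by move=> x h x1; apply: s1; rewrite -x1.
by have [c hc _] := weakly_regular_chain ideal_zero sreg GQ; exists c.
Qed.

End Ideals.

(** * Localization *)

Section LocalizedIdeals.
Variables (S L : comNzRingType) (phi : {rmorphism S -> L}).
Variables (I D : S -> Prop).

(** [phi] exhibits [L] as the localization of [S/I] at the image of [D].  Going
    directly from [S] to [L] keeps all computations in the polynomial ring. *)
Record is_localization : Prop := IsLocalization {
  loc_ideal : is_ideal I;
  loc_denom1 : D 1;
  loc_denomM : forall x y, D x -> D y -> D (x * y);
  loc_frac : forall y, exists a d, D d /\ y * phi d = phi a;
  loc_unit : forall d, D d -> exists e, e * phi d = 1;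
  loc_ker : forall x, phi x = 0 <-> exists2 u, D u & I (u * x)
}.

Hypothesis philoc : is_localization.

(** The extension of the ideal [J] to [L]. *)
Definition loc_ext (J : S -> Prop) : L -> Prop :=
  fun y => exists a d, [/\ D d, J a & y * phi d = phi a].

Lemma loc_eq x y : phi x = phi y -> exists2 u, D u & I (u * x - u * y).
Proof.
move=> e; have /(loc_ker philoc)[u Du h] : phi (x - y) = 0.
  by rewrite rmorphB e subrr.
by exists u => //; rewrite -mulrBr.
Qed.

Lemma loc_ext_ideal J : is_ideal J -> is_ideal (loc_ext J).
Proof.
case=> J0 JD JM; have D1 := loc_denom1 philoc; have DM := loc_denomM philoc; split.
- by exists 0, 1; split=> //; rewrite mul0r rmorph0.
- move=> x y [a [d [Dd Ja ea]]] [b [e [De Jb eb]]]; exists (e * a + d * b), (d * e).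
  split; [exact: DM|by apply: JD; apply: JM|].
  by rewrite !rmorphD !rmorphM -ea -eb; ring.
- move=> z x [a [d [Dd Ja ea]]]; have [b [e [De eb]]] := loc_frac philoc z.
  exists (b * a), (e * d); split; [exact: DM|exact: JM|].
  by rewrite !rmorphM -ea -eb; ring.
Qed.

Lemma loc_ext_base : loc_ext I = fun y => y = 0.
Proof.
apply/funext => y; apply/propext; split=> [[a [d [Dd Ia e]]]|->].
- have a0 : phi a = 0.
    apply/(loc_ker philoc); exists 1; first exact: loc_denom1.
    by rewrite mul1r.
  have [b hb] := loc_unit philoc Dd.
  by rewrite -[y]mulr1 -hb mulrCA e a0 mulr0.
- exists 0, 1; split; first exact: loc_denom1.
    by case: (loc_ideal philoc).
  by rewrite mul0r rmorph0.
Qed.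

Lemma loc_ext_adjoin J f : is_ideal J ->
  loc_ext (adjoin_ideal J f) = adjoin_ideal (loc_ext J) (phi f).
Proof.
move=> [J0 JD JM]; have DM := loc_denomM philoc.
apply/funext => y; apply/propext; split.
- move=> [a [d [Dd [c Jc] e]]]; have [b hb] := loc_unit philoc Dd.
  exists (b * phi c), (a - c * f), d; split=> //.
  rewrite rmorphB rmorphM -e.
  transitivity (y * phi d - (b * phi d) * phi c * phi f); first by ring.
  by rewrite hb mul1r.
- move=> [c [a [d [Dd Ja e]]]]; have [b [d' [Dd' hb]]] := loc_frac philoc c.
  exists (d' * a + b * d * f), (d * d'); split; first exact: DM.
    by exists (b * d); rewrite addrK; exact: JM.
  by rewrite !rmorphD !rmorphM -e -hb; ring.
Qed.

(** Localization is exact: an equation in [L] becomes one modulo [J] in [S]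
    after multiplication by a denominator. *)
Lemma loc_weakly_regular J s : is_ideal J -> (forall x, I x -> J x) ->
  weakly_regular J s -> weakly_regular (loc_ext J) (map phi s).
Proof.
elim: s J => //= f s IH J iJ IJ [fJ sJ]; have [J0 JD JM] := iJ.
split; last first.
  rewrite -loc_ext_adjoin //; apply: IH => //; first exact: adjoin_is_ideal.
  by move=> x /IJ; exact: sub_adjoin.
move=> y [a [d [Dd Ja ea]]].
have [b [e [De eb]]] := loc_frac philoc y.
have /loc_eq[u Du /IJ hu] : phi (f * b * d) = phi (a * e).
  by rewrite !rmorphM -eb -ea; ring.
exists (u * d * b), (u * d * e); split.
- by do ! apply: (loc_denomM philoc).
- apply: fJ; have := JD _ _ hu (JM (u * e) _ Ja); congr J; ring.
- by rewrite !rmorphM -eb; ring.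
Qed.

(** The sequence consists of nonunits and generates a proper ideal since it lies
    in the extension of [M], which does not meet the denominators. *)
Lemma loc_regular_seq s (M : S -> Prop) : is_ideal M ->
  (forall x, M x -> ~ D x) -> (forall x, I x -> M x) -> {in s, forall x, M x} ->
  weakly_regular I s ->
  regular_seq (map phi s) /\ all [in @nonunits L] (map phi s).
Proof.
move=> iM MD IM sM sreg; have iI := loc_ideal philoc.
have M1 : ~ loc_ext M 1.
  move=> [a [d [Dd Ma]]]; rewrite mul1r => /loc_eq[u Du /IM hu].
  have [_ MD' MM] := iM; apply: (MD (u * d)); last exact: (loc_denomM philoc).
  by have := MD' _ _ hu (MM u _ Ma); rewrite subrK.
have sM' : {in map phi s, forall y, loc_ext M y}.
  move=> _ /mapP[x xs ->]; exists x, 1; split; [exact: loc_denom1|exact: sM|].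
  by rewrite rmorph1 mulr1.
have iM' := loc_ext_ideal iM; have [M0 _ MM] := iM'.
split.
  apply/regular_seqP; split.
    by have := loc_weakly_regular iI (fun x h => h) sreg; rewrite loc_ext_base.
  by move/(gens_min (K := loc_ext M) iM') => h; apply/M1/h => // _ ->.
apply/allP => y ys; apply/asboolP => -[z hz].
by apply: M1; rewrite -hz; apply: MM; apply: sM'.
Qed.

End LocalizedIdeals.

Section LocalizationMap.
Variables (R : comNzRingType) (p : prime_idealr R).
Local Notation L := (localization p).

Definition to_loc (x : R) : L :=
  \pi_(Localization.type p) (Localization.mk x (Localization.notin1 p)).

Lemma pi_locD (x y : Localization.frac p) :
  (\pi_(Localization.type p) (Localization.addf x y) : L) =
  (\pi_(Localization.type p) x : L) + (\pi_(Localization.type p) y : L).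
Proof. exact: Localization.pi_add. Qed.

Lemma pi_locN (x : Localization.frac p) :
  (\pi_(Localization.type p) (Localization.oppf x) : L) =
  - (\pi_(Localization.type p) x : L).
Proof. exact: Localization.pi_opp. Qed.

Lemma pi_locM (x y : Localization.frac p) :
  (\pi_(Localization.type p) (Localization.mulf x y) : L) =
  (\pi_(Localization.type p) x : L) * (\pi_(Localization.type p) y : L).
Proof. exact: Localization.pi_mul. Qed.

Lemma to_loc_zmod_morphism : zmod_morphism to_loc.
Proof.
move=> x y; rewrite /to_loc -pi_locN -pi_locD.
by apply: Localization.eq_pi => /=; ring.
Qed.

Lemma to_loc_monoid_morphism : monoid_morphism to_loc.
Proof.
split=> [|x y]; first by rewrite /to_loc [1 in RHS](piE (Localization.pi_one_morph p)).
by rewrite /to_loc -pi_locM; apply: Localization.eq_pi => /=; ring.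
Qed.

HB.instance Definition _ :=
  GRing.isZmodMorphism.Build R L to_loc to_loc_zmod_morphism.
HB.instance Definition _ :=
  GRing.isMonoidMorphism.Build R L to_loc to_loc_monoid_morphism.

Lemma to_loc_localization (S : comNzRingType) (q : {rmorphism S -> R}) :
  (forall y, exists x, q x = y) ->
  is_localization (to_loc \o q) (fun x => q x = 0) (fun x => q x \notin p).
Proof.
move=> qsurj; have DM x y : q x \notin p -> q y \notin p -> q (x * y) \notin p.
  by rewrite rmorphM; exact: Localization.notinM.
have mkE (x : Localization.frac p) :
    (\pi_(Localization.type p) x : L) * to_loc (val x).2 = to_loc (val x).1.
  by rewrite /to_loc -pi_locM; apply: Localization.eq_pi => /=; ring.
split.
- split=> [|x y|a x]; first exact: rmorph0.
    by rewrite rmorphD => -> ->; rewrite addr0.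
  by rewrite rmorphM => ->; rewrite mulr0.
- by rewrite rmorph1 idealr1.
- exact: DM.
- elim/quotW=> x; have [a ea] := qsurj (val x).1; have [d ed] := qsurj (val x).2.
  by exists a, d; rewrite /= ea ed (valP x) mkE.
- move=> d hd; exists (\pi_(Localization.type p) (Localization.mk 1 hd)).
  by rewrite (mkE (Localization.mk 1 hd)) /= rmorph1.
- move=> x; split=> [/=|[u hu hux] /=].
    move/eqP; rewrite -(rmorph0 (to_loc : {rmorphism _ -> _})).
    move=> /Localization.equivP[u]; rewrite /= !mulr1 mulr0.
    have [v <-] := qsurj u; rewrite -rmorphM => hv huv; by exists v.
  have -> : to_loc (q x) = (\pi_(Localization.type p) (Localization.mk (q u * q x) hu) : L).
    by apply: Localization.eq_pi => /=; ring.
  rewrite -(rmorph0 (to_loc : {rmorphism _ -> _})).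
  by apply: Localization.eq_pi => /=; rewrite -rmorphM hux; ring.
Qed.

End LocalizationMap.

(** * Zariski's lemma *)

Section Goldman.
Variable K : fieldType.

Definition adjoin_ring (D : {pred K}) (x : K) : {pred K} :=
  [pred y | `[< exists2 p, p \is a polyOver D & y = p.[x] >]].

(** [D] is a Goldman domain: its fraction field is [D[1/u]] for a single [u]. *)
Definition goldman (D : {pred K}) := exists2 u, u \in D & u != 0 /\
  forall r, r \in D -> r != 0 -> exists m, exists2 s, s \in D & r * s = u ^+ m.

Definition algebraic_over (D : {pred K}) (x : K) :=
  exists2 p, p \is a polyOver D & p != 0 /\ p.[x] = 0.

Variables (D : subringClosed K) (x : K).

Lemma adjoin_ring_closed : subring_closed (adjoin_ring D x).
Proof.
split.
- by apply/asboolP; exists 1; rewrite ?rpred1 ?hornerC.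
- move=> _ _ /asboolP[p hp ->] /asboolP[q hq ->]; apply/asboolP.
  by exists (p - q); rewrite ?rpredB // !hornerE.
- move=> _ _ /asboolP[p hp ->] /asboolP[q hq ->]; apply/asboolP.
  by exists (p * q); rewrite ?rpredM // !hornerE.
Qed.

HB.instance Definition _ :=
  GRing.isSubringClosed.Build K (adjoin_ring D x) adjoin_ring_closed.

Lemma sub_adjoin_ring y : y \in D -> y \in adjoin_ring D x.
Proof. by move=> yD; apply/asboolP; exists y%:P; rewrite ?polyOverC ?hornerC. Qed.

Lemma mem_adjoin_ring : x \in adjoin_ring D x.
Proof. by apply/asboolP; exists 'X; rewrite ?polyOverX ?hornerX. Qed.

(** Division with remainder that stays inside [D[X]], at the price of a power of
    the leading coefficient of the divisor. *)
Lemma pseudo_division (p q : {poly K}) : p \is a polyOver D -> q \is a polyOver D ->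
  q != 0 -> exists N d r, [/\ d \is a polyOver D, r \is a polyOver D,
    (size r < size q)%N & lead_coef q ^+ N *: p = d * q + r].
Proof.
move=> hp hq q0; have lqD : lead_coef q \in D by exact: (polyOverP hq).
have [n] := ubnP (size p); elim: n p hp => // n IH p hp; rewrite ltnS => len.
have [lt|le] := ltnP (size p) (size q).
  by exists 0%N, 0, p; rewrite rpred0 expr0 scale1r mul0r add0r.
pose k := (size p - size q)%N; pose c := lead_coef p.
have cD : c \in D by exact: (polyOverP hp).
pose p' := lead_coef q *: p - c *: (q * 'X^k).
have hp' : p' \is a polyOver D.
  by rewrite rpredB ?polyOverZ // rpredM // rpredX // polyOverX.
have q0' : (0 < size q)%N by rewrite size_poly_gt0.
have p0 : (0 < size p)%N by exact: leq_trans q0' le.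
have k1 : (k <= (size p).-1)%N by rewrite /k; lia.
have k2 : ((size p).-1 - k)%N = (size q).-1 by rewrite /k; lia.
have k3 j : (j > (size p).-1)%N -> (size p <= j)%N /\ (size q <= j - k)%N.
  by rewrite /k; lia.
have sp' : (size p' < size p)%N.
  rewrite -[size p]prednK // ltnS; apply/leq_sizeP => j hj.
  rewrite coefB !coefZ coefMXn; move: hj; rewrite leq_eqVlt => /predU1P[<-|hj].
    rewrite ltnNge k1 /= k2.
    by rewrite -/(lead_coef p) -/(lead_coef q) mulrC subrr.
  have [j1 j2] := k3 _ hj.
  by rewrite [p`_j]nth_default // [q`_(j - k)]nth_default // if_same !mulr0 subrr.
have [N [d [r [hd hr sr e]]]] := IH _ hp' (leq_trans sp' len).
exists N.+1, (d + (lead_coef q ^+ N * c) *: 'X^k), r; split=> //.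
  by rewrite rpredD // polyOverZ ?rpredM ?rpredX ?polyOverX.
rewrite mulrDl addrAC -e /p' scalerBr !scalerA -exprSr -scalerAl.
by rewrite (mulrC 'X^k) subrK.
Qed.

(** A polynomial ring [D[X]] is not a Goldman domain: [1 + X V] would divide a
    power of [V], although it is coprime to [V]. *)
Lemma goldman_algebraic : goldman (adjoin_ring D x) -> algebraic_over D x.
Proof.
case=> u /asboolP[V hV ->] [V0 hu]; apply: contrapT => nalg.
have inj p : p \is a polyOver D -> p.[x] = 0 -> p = 0.
  by move=> hp px; apply/eqP; apply: contraT => p0; case: nalg; exists p.
pose r := 1 + 'X * V.
have hr : r \is a polyOver D by rewrite rpredD ?rpred1 // rpredM ?polyOverX.
have r0 : r != 0.
  apply/eqP => /(congr1 (fun p : {poly K} => p`_0)) /eqP.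
  by rewrite coefD coefXM coef1 addr0 coef0 oner_eq0.
have rx0 : r.[x] != 0 by apply: contraNneq r0 => /inj ->.
have [|m [_ /asboolP[W hW ->] e]] := hu r.[x] _ rx0.
  by apply/asboolP; exists r.
have {}e : r * W = V ^+ m.
  apply/eqP; rewrite -subr_eq0; apply/eqP/inj.
    by rewrite rpredB ?rpredM ?rpredX.
  by rewrite hornerD hornerN hornerM horner_exp e subrr.
have cop : coprimep r (V ^+ m).
  apply: coprimep_expr; apply/Bezout_eq1_coprimepP.
  by exists (1, - 'X) => /=; rewrite /r; ring.
have : size r == 1%N.
  by move: cop; rewrite -e coprimepMr coprimepp => /andP[].
have Vn0 : V != 0 by apply: contraNneq V0 => ->; rewrite horner0.
have sV : (0 < size V)%N by rewrite size_poly_gt0.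
by rewrite /r addrC size_polyDl mulrC size_mulX // ?size_poly1 // eqSS -leqn0 leqNgt sV.
Qed.

(** Let [P] be of minimal degree among the nonzero polynomials over [D] that
    vanish at [x], and [a] its leading coefficient.  Some nonzero multiple [b] of
    the witness for [D[x]] lies in [D], and [a * b] is a witness for [D]: if
    [r * s = b ^+ m], then [a ^+ N * s] is the value at [x] of a polynomial [q] of
    degree less than [P], so [r * q = a ^+ N * b ^+ m] holds for polynomials, and
    its constant term is the required identity in [D]. *)
Lemma goldman_descent : goldman (adjoin_ring D x) -> goldman D.
Proof.
move=> gD; have [P hP [P0 Px]] := goldman_algebraic gD.
have [n] := ubnP (size P); elim: n P hP P0 Px => // n IH P hP P0 Px; rewrite ltnS => len.
have [[P' [hP' P'0 P'x sP']]|minP] :=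
    pselect (exists P', [/\ P' \is a polyOver D, P' != 0, P'.[x] = 0 & (size P' < size P)%N]).
  by apply: (IH P') => //; exact: leq_trans sP' len.
have {IH len} inj p : p \is a polyOver D -> (size p < size P)%N -> p.[x] = 0 -> p = 0.
  move=> hp sp px; apply/eqP; apply: contraT => p0.
  by case: minP; exists p.
have {minP} sP : (1 < size P)%N.
  rewrite ltnNge; apply/negP => /size1_polyC eP; move: Px P0.
  by rewrite eP hornerC => ->; rewrite eqxx.
pose a := lead_coef P; have aD : a \in D by exact: (polyOverP hP).
have a0 : a != 0 by rewrite lead_coef_eq0.
have red p : p \is a polyOver D -> exists N q,
    [/\ q \is a polyOver D, (size q < size P)%N & a ^+ N * p.[x] = q.[x]].
  move=> hp; have [N [d [q [hd hq sq e]]]] := pseudo_division hp hP P0.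
  exists N, q; split=> //; move/(congr1 (horner^~ x)): e.
  by rewrite hornerZ hornerD hornerM Px mulr0 add0r.
(* Dividing [P] by [Q] replaces a multiple [Q.[x]] of [w] by one of lower degree;
   it is nonzero because the quotient has smaller degree than [P]. *)
have norm w : w \in adjoin_ring D x -> w != 0 ->
    exists z b, [/\ z \in adjoin_ring D x, b \in D, b != 0 & w * z = b].
  move=> wD w0.
  have [N [Q [hQ sQ Qx]]] : exists N q,
     [/\ q \is a polyOver D, (size q < size P)%N & a ^+ N * w = q.[x]].
    by move/asboolP: (wD) => [p /red hp ->].
  have : exists z, z \in adjoin_ring D x /\ w * z = Q.[x].
    by exists (a ^+ N); rewrite mulrC; split=> //; rewrite rpredX ?sub_adjoin_ring.
  have : Q.[x] != 0 by rewrite -Qx mulf_neq0 // expf_neq0.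
  have [m] := ubnP (size Q); move: {N Qx} Q hQ sQ.
  elim: m => // m IHm Q hQ sQ; rewrite ltnS => lem Q0 [z [zD ez]].
  have Qn0 : Q != 0 by apply: contraNneq Q0 => ->; rewrite horner0.
  have [sQ1|sQ1] := leqP (size Q) 1.
    have QE : Q.[x] = Q`_0 by rewrite {1}(size1_polyC sQ1) hornerC.
    have QD : Q`_0 \in D by exact: (polyOverP hQ).
    by exists z, Q`_0; split; rewrite // -QE.
  have [N [d [r [hd hr sr e]]]] := pseudo_division hP hQ Qn0.
  have e' : r.[x] = - (d.[x] * Q.[x]).
    move/(congr1 (horner^~ x)): e; rewrite hornerZ Px mulr0 hornerD hornerM => /esym/eqP.
    by rewrite addrC addr_eq0 => /eqP.
  have lcQ : lead_coef Q != 0 by rewrite lead_coef_eq0.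
  have d0 : d != 0.
    apply: contraTneq sr => d0; rewrite -leqNgt.
    by move: e; rewrite d0 mul0r add0r => <-; rewrite size_scale ?expf_neq0 // ltnW.
  have sd : (size d < size P)%N.
    have : (size (d * Q)%R <= size P)%N.
      rewrite (_ : d * Q = lead_coef Q ^+ N *: P - r); last by rewrite e addrK.
      rewrite (leq_trans (size_polyD _ _)) // geq_max size_polyN.
      by rewrite size_scale ?expf_neq0 // leqnn /= ltnW // (ltn_trans sr).
    rewrite size_mul // => h; apply: leq_trans h.
    by move: sQ1; case: (size Q) => [|[|j]] // _; rewrite !addnS /= ltnS leq_addr.
  have dx0 : d.[x] != 0 by apply: contraNneq d0 => /inj ->.
  apply: (IHm r hr).
  - exact: ltn_trans sr sQ.
  - exact: leq_trans sr lem.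
  - by rewrite e' oppr_eq0 mulf_neq0.
  - exists (- (d.[x] * z)); split.
      by rewrite rpredN rpredM //; apply/asboolP; exists d.
    by rewrite e' -ez; ring.
have [v vD [v0 hv]] := gD.
have [z [b [zD bD b0 eb]]] := norm v vD v0.
exists (a * b); first exact: rpredM.
split=> [|r rD r0]; first exact: mulf_neq0.
have [m [s sD e]] := hv r (sub_adjoin_ring rD) r0.
have [N [q [hq sq eq]]] : exists N q,
     [/\ q \is a polyOver D, (size q < size P)%N & a ^+ N * (s * z ^+ m) = q.[x]].
  have : s * z ^+ m \in adjoin_ring D x by rewrite rpredM ?rpredX.
  by move/asboolP => [p /red hp ->].
have q0E : r * q`_0 = a ^+ N * b ^+ m.
  pose p := r *: q - (a ^+ N * b ^+ m)%:P.
  have p0 : p = 0.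
    apply: inj.
    - by rewrite rpredB ?polyOverZ ?polyOverC ?rpredM ?rpredX.
    - rewrite (leq_ltn_trans (size_polyD _ _)) // gtn_max size_polyN size_scale // sq.
      by rewrite (leq_ltn_trans (size_polyC_leq1 _)).
    - by rewrite hornerD hornerN hornerC hornerZ -eq -eb exprMn -e; ring.
  move/(congr1 (fun p : {poly K} => p`_0)): p0.
  by rewrite coef0 coefB coefZ coefC /= => /eqP; rewrite subr_eq0 => /eqP.
exists (N + m)%N, (q`_0 * a ^+ m * b ^+ N).
  by rewrite !rpredM ?rpredX //; exact: (polyOverP hq).
by rewrite !mulrA q0E exprMn !exprD; ring.
Qed.

End Goldman.

Lemma mpoly_ring_ind (k : fieldType) (n : nat) (P : {mpoly k[n]} -> Prop) :
  (forall c, P c%:MP) -> (forall i, P 'X_i) -> (forall p q, P p -> P q -> P (p + q)) ->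
  (forall p q, P p -> P q -> P (p * q)) -> forall p, P p.
Proof.
move=> PC PX PD PM p; have P1 : P 1 by rewrite -mpolyC1; exact: PC.
rewrite [p]mpolyE; apply: big_ind; [by rewrite -mpolyC0; exact: PC|exact: PD|].
move=> m _; rewrite -mul_mpolyC; apply: (PM); first exact: PC.
rewrite mpolyXE_id; apply: (big_ind P P1 PM) => i _.
by elim: (m i) => [|j IH]; rewrite ?exprS //; exact: PM.
Qed.

Section Zariski.
Variables (k K : fieldType) (n : nat) (phi : {rmorphism {mpoly k[n]} -> K}).
Hypothesis phi_surj : forall y, exists q, phi q = y.

(** The field [K], a Goldman domain, is obtained from the image of [k] by
    adjoining [y] first and then the images of the variables.  Descending along
    the latter makes [k[y]] a Goldman domain, so [y] is algebraic. *)
Lemma zariski (y : K) : exists f : {poly k}, f != 0 /\ (map_poly (phi \o @mpolyC n k) f).[y] = 0.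
Proof.
pose D0 : {pred K} := [pred z | `[< exists c, z = phi c%:MP >]].
have D0c : subring_closed D0.
  split.
  - by apply/asboolP; exists 1; rewrite rmorph1.
  - move=> _ _ /asboolP[c ->] /asboolP[d ->]; apply/asboolP.
    by exists (c - d); rewrite mpolyCB rmorphB.
  - move=> _ _ /asboolP[c ->] /asboolP[d ->]; apply/asboolP.
    by exists (c * d); rewrite mpolyCM rmorphM.
pose D0i := GRing.isSubringClosed.Build K D0 D0c.
pose D : subringClosed K := HB.pack D0 D0i.
pose step (E : subringClosed K) x : subringClosed K := adjoin_ring E x.
pose E := foldl step (step D y) [seq phi 'X_i | i <- enum 'I_n].
have subE s (F : subringClosed K) : {subset F <= foldl step F s} /\ {subset s <= foldl step F s}.
  elim: s F => [|x s IH] F /=; first by split.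
  have [h1 h2] := IH (step F x); split=> z.
    by move=> zF; apply/h1/sub_adjoin_ring.
  by rewrite inE => /predU1P[->|/h2 //]; apply/h1/mem_adjoin_ring.
have [sub1 sub2] := subE [seq phi 'X_i | i <- enum 'I_n] (step D y).
have Efull z : z \in E.
  have [q <-] := phi_surj z; elim/mpoly_ring_ind: q.
  - by move=> c; apply/sub1/sub_adjoin_ring/asboolP; exists c.
  - by move=> i; apply/sub2/map_f; rewrite mem_enum.
  - by move=> p q hp hq; rewrite rmorphD rpredD.
  - by move=> p q hp hq; rewrite rmorphM rpredM.
have gE : goldman E.
  exists 1 => //; split=> [|r _ r0]; first exact: oner_neq0.
  by exists 0%N, r^-1; rewrite ?divff.
have desc s (F : subringClosed K) : goldman (foldl step F s) -> goldman F.
  by elim: s F => //= x s IH F /IH/goldman_descent.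
have [p hp [p0 py]] := goldman_algebraic (desc _ _ gE).
have /choice[g hg] i : exists c, p`_i = phi c%:MP.
  by have /polyOverP/(_ i)/asboolP := hp.
have e : map_poly (phi \o @mpolyC n k) (\poly_(i < size p) g i) = p.
  apply/polyP => i; rewrite coef_map coef_poly; case: ltnP => [_|h].
    by rewrite /= hg.
  by rewrite /= mpolyC0 rmorph0 nth_default.
exists (\poly_(i < size p) g i); rewrite e; split=> //.
by apply: contraNneq p0 => h; rewrite -e h map_poly0.
Qed.

End Zariski.

(** * Dimension of quotients of polynomial rings *)

Section Evaluation.
Variables (k : fieldType).

Lemma mpoly_rmorph_ext n (B : comNzRingType) (f g : {rmorphism {mpoly k[n]} -> B}) :
  (forall c, f c%:MP = g c%:MP) -> (forall i, f 'X_i = g 'X_i) -> f =1 g.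
Proof.
move=> fgC fgX; apply: mpoly_ring_ind => // p q hp hq.
  by rewrite !rmorphD hp hq.
by rewrite !rmorphM hp hq.
Qed.

Lemma mmap_comp n N (B : comNzRingType) (f : {rmorphism k -> B}) (h : 'I_n -> B)
    (q : 'I_N -> {mpoly k[n]}) (Q : {mpoly k[N]}) :
  mmap f h (mmap (@mpolyC n k) q Q) = mmap f (fun i => mmap f h (q i)) Q.
Proof.
pose F : {rmorphism {mpoly k[N]} -> B} := mmap f h \o mmap (@mpolyC n k) q.
apply: (mpoly_rmorph_ext (f := F)) => [c|i] /=; first by rewrite !mmapC.
by rewrite !mmapX !mmap1U.
Qed.

Lemma mmap_id n (q : {mpoly k[n]}) : mmap (@mpolyC n k) (fun i => 'X_i) q = q.
Proof.
apply: (mpoly_rmorph_ext (g := idfun)) => [c|i] /=; first by rewrite mmapC.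
by rewrite mmapX mmap1U.
Qed.

(** The isomorphism onto polynomials in the first variable. *)
Definition mpop n : {mpoly k[n.+1]} -> {poly {mpoly k[n]}} :=
  mmap (polyC \o @mpolyC n k)
       (fun i => if unlift ord0 i is Some j then ('X_j)%:P else 'X).

Lemma mmap_pop n (B : comNzRingType) (f : {rmorphism k -> B}) (h : 'I_n.+1 -> B) Q :
  mmap f h Q = (map_poly (mmap f (h \o lift ord0)) (mpop Q)).[h ord0].
Proof.
pose pop : {rmorphism {mpoly k[n.+1]} -> {poly {mpoly k[n]}}} :=
  mmap (polyC \o @mpolyC n k)
       (fun i => if unlift ord0 i is Some j then ('X_j)%:P else 'X).
pose ev : {rmorphism {mpoly k[n.+1]} -> B} :=
  horner_eval (h ord0) \o (map_poly (mmap f (h \o lift ord0)) \o pop).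
apply: (mpoly_rmorph_ext (g := ev)) => [c|i] /=; rewrite /mpop /horner_eval.
  by rewrite !mmapC /= map_polyC hornerC /= mmapC.
rewrite !mmapX !mmap1U; case: unliftP => [j|] -> /=.
  by rewrite map_polyC hornerC /= mmapX mmap1U.
by rewrite map_polyX hornerX.
Qed.

Lemma mpop_eq0 n (Q : {mpoly k[n.+1]}) : mpop Q = 0 -> Q = 0.
Proof. by move=> Q0; rewrite -[Q]mmap_id mmap_pop Q0 map_poly0 horner0. Qed.

Lemma prime_idealrX (B : comNzRingType) (p : prime_idealr B) x m :
  x ^+ m \in p -> x \in p.
Proof.
elim: m => [|m IH]; first by rewrite expr0 idealr1.
by rewrite exprS prime_idealrM => /orP[].
Qed.

(** Write [Q] as [z ^+ m * p], where [z] is the first variable and [p] has a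
    nonzero constant term [p_0] in [z].  As the value of [z] is outside [c 0] but in
    [c 1], the value of [p] is in [c 0] and that of [p_0] in [c 1]; [p_0] has one
    variable less. *)
Lemma prime_chain_no_relation N (B : comNzRingType) (f : {rmorphism k -> B})
    (h : 'I_N -> B) (c : nat -> prime_idealr B) (Q : {mpoly k[N]}) :
  (forall i, (i < N)%N -> {subset c i <= c i.+1}) ->
  (forall i : 'I_N, h i \in c i.+1 /\ h i \notin c i) ->
  mmap f h Q \in c 0%N -> Q = 0.
Proof.
elim: N h c Q => [|N IH] h c Q sub hc hQ.
  have eQ : Q = (Q@_0)%:MP.
    apply/mpolyP => m; rewrite mcoeffC.
    by have -> : m = 0%MM; [apply/mnmP; case|rewrite eqxx mulr1].
  move: hQ; rewrite eQ mmapC => hQ; apply/eqP; rewrite mpolyC_eq0; apply: contraT => Q0.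
  have := idealMr (f (Q@_0)^-1) hQ.
  by rewrite -rmorphM mulVf // rmorph1 idealr1.
apply/mpop_eq0; have [m [p]] := multiplicity_XsubC (mpop Q) 0.
have [->//|Q0 /= p0 eQ] := eqVneq (mpop Q) 0.
move: hQ; rewrite mmap_pop eQ rmorphM rmorphXn /= hornerM horner_exp.
rewrite map_polyXsubC rmorph0 !hornerE prime_idealrM => /orP[hp|]; last first.
  have hc0 : h ord0 \notin c 0%N := (hc ord0).2.
  by move/prime_idealrX; rewrite subr0 (negPf hc0).
case/negP: p0; apply/rootP.
apply: (IH (h \o lift ord0) (fun i => c i.+1)).
- by move=> i lti; apply: sub.
- by move=> i; have := hc (lift ord0 i); rewrite lift0.
- have {}hp := sub 0%N isT _ hp; rewrite horner_coef0.
  elim/poly_ind: p hp {eQ} => [|p a _] hp; first by rewrite coef0 mmap0 idealr0.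
  move: hp; rewrite rmorphD rmorphM /= map_polyX map_polyC hornerD hornerM hornerX hornerC.
  rewrite coefD coefMX coefC /= add0r => h1.
  have h2 := idealMr (map_poly (mmap f (h \o lift ord0)) p).[h ord0] (hc ord0).1.
  by have := rpredB h1 h2; rewrite addrAC subrr add0r.
Qed.

End Evaluation.

Section Dependence.
Variables (k : fieldType) (n N : nat) (q : 'I_N -> {mpoly k[n]}).

Lemma msizeM_leq (p p' : {mpoly k[n]}) s s' :
  (msize p <= s.+1)%N -> (msize p' <= s'.+1)%N -> (msize (p * p') <= (s + s').+1)%N.
Proof.
have [->|p0] := eqVneq p 0; first by rewrite mul0r msize0.
have [->|p'0] := eqVneq p' 0; first by rewrite mulr0 msize0.
rewrite msizeM // => h h'; have := leq_add h h'.
by case: (_ + _)%N => // j; rewrite addSn addnS ltnS.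
Qed.

(** There are [M ^ N] monomials in [N] letters with exponents below [M]; their
    values at [q] have degree at most [T], linear in [M], so they lie in a space
    of dimension at most [T.+1 ^ n], which is smaller once [M] is large. *)
Lemma algebraic_dependence : (n < N)%N ->
  exists2 Q : {mpoly k[N]}, Q != 0 & mmap (@mpolyC n k) q Q = 0.
Proof.
move=> ltnN.
pose D := \max_(i < N) msize (q i).
pose M := ((N * D).+1 ^ n).+1.
pose T := (N * (M * D))%N.
pose E := {ffun 'I_N -> 'I_M}; pose F := {ffun 'I_n -> 'I_T.+1}.
pose zmon (e : E) : 'X_{1..N} := [multinom val (e i) | i < N].
pose ymon (e : F) : 'X_{1..n} := [multinom val (e i) | i < n].
pose g (e : E) := mmap1 q (zmon e).
have size_pow i j : (msize (q i ^+ j) <= (j * D).+1)%N.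
  elim: j => [|j IH]; first by rewrite expr0 msize1.
  by rewrite exprS mulSn; apply: msizeM_leq IH; rewrite leqW // (leq_bigmax i).
have size_g e : (msize (g e) <= T.+1)%N.
  have -> : T = (\sum_(i < N) M * D)%N by rewrite sum_nat_const card_ord.
  rewrite /g /mmap1.
  apply: (@big_ind2 _ _ (fun (p : {mpoly k[n]}) s => (msize p <= s.+1)%N)).
  - by rewrite msize1.
  - by move=> p s p' s'; exact: msizeM_leq.
  - move=> i _; rewrite (leq_trans (size_pow _ _)) // ltnS leq_mul2r mnmE.
    by rewrite (ltnW (ltn_ord _)) orbT.
pose A : 'M[k]_(#|E|, #|F|) := \matrix_(a, b) (g (enum_val a))@_(ymon (enum_val b)).
have cardEF : (#|F| < #|E|)%N.
  rewrite !card_ffun !card_ord.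
  have -> : N = (n.+1 + (N - n.+1))%N by rewrite subnKC.
  rewrite expnD (leq_trans _ (leq_pmulr _ _)) ?expn_gt0 //.
  have hT : (T.+1 <= M * (N * D).+1)%N by rewrite /T /M; nia.
  have hTn j : (T.+1 ^ j <= (M * (N * D).+1) ^ j)%N.
    by elim: j => // j IH; rewrite !expnS leq_mul.
  apply: leq_ltn_trans (hTn n) _.
  by rewrite expnMn expnS mulnC ltn_pmul2r ?expn_gt0.
have /rowV0Pn[v /sub_kermxP vA v0] : kermx A != 0.
  rewrite kermx_eq0 -row_leq_rank -ltnNge.
  exact: leq_ltn_trans (rank_leq_col A) cardEF.
have zmon_inj : injective zmon.
  move=> e e' ee; apply/ffunP => i; apply/val_inj.
  by have /mnmP/(_ i) := ee; rewrite !mnmE.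
exists (\sum_a v 0 a *: 'X_[zmon (enum_val a)]).
  apply: contraNneq v0 => /mpolyP h; apply/eqP/rowP => a.
  have := h (zmon (enum_val a)); rewrite mcoeff0 raddf_sum /= mxE (bigD1 a) //=.
  rewrite mcoeffZ mcoeffX eqxx mulr1 big1 ?addr0 // => b ba.
  rewrite mcoeffZ mcoeffX (inj_eq zmon_inj) (inj_eq enum_val_inj).
  by rewrite (negPf ba) mulr0.
rewrite raddf_sum /=; apply/mpolyP => m; rewrite mcoeff0 raddf_sum /=.
under eq_bigr => a _ do rewrite mmapZ mmapX mcoeffCM -/(g _).
have [le|lt] := leqP (mdeg m) T; last first.
  rewrite big1 // => a _; rewrite memN_msupp_eq0 ?mulr0 //.
  by rewrite msize_mdeg_ge // (leq_trans (size_g _)).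
have mi i : (m i < T.+1)%N.
  by rewrite ltnS (leq_trans _ le) // mdegE (bigD1 i) //= leq_addr.
pose e : F := [ffun i => Ordinal (mi i)].
have -> : m = ymon e by apply/mnmP => i; rewrite mnmE ffunE.
move/rowP: vA => /(_ (enum_rank e)); rewrite [LHS]mxE [RHS]mxE => h.
by rewrite -[RHS]h; apply: eq_bigr => a _; rewrite mxE enum_rankK.
Qed.

End Dependence.

Section KrullBound.
Variables (k : fieldType) (v n : nat) (L : comNzRingType).
Variables (phi : {rmorphism {mpoly k[v]} -> L}) (col : 'I_v -> 'I_n).
Hypothesis phi_frac : forall y, exists a d e, y * phi d = phi a /\ phi d * e = 1.
Hypothesis phi_col : forall i j, i != j -> col i = col j -> phi 'X_i * phi 'X_j = 0.

(** Modulo the prime [c 0] the variables of colour [i] are all zero except at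
    most one, whose value is [z i]; thus each [phi p] is a polynomial in the [n]
    elements [z i], and any [n.+1] such elements are dependent. *)
Lemma krull_bound (c : nat -> prime_idealr L) d : prime_chain c d -> (d <= n)%N.
Proof.
move=> hc; rewrite leqNgt; apply/negP => ltnd.
have c0 j : (j <= d)%N -> {subset c 0%N <= c j}.
  elim: j => [_ x //|j IH ltj x /(IH (ltnW ltj))]; exact: (hc j ltj).1.
have /choice[a ha] (j : 'I_n.+1) : exists a, phi a \in c j.+1 /\ phi a \notin c j.
  have [_ nsub] := hc j (leq_trans (ltn_ord j) ltnd).
  have [y yin yout] : exists2 y, y \in c j.+1 & y \notin c j.
    apply: contrapT => h; apply: nsub => y hy; apply: contraT => hy'.
    by case: h; exists y.
  have [a [b [e [eab eb]]]] := phi_frac y; exists a; rewrite -eab; split.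
    by rewrite mulrC idealMr.
  rewrite prime_idealrM negb_or yout /=; apply/negP => hb.
  by have := idealMr e hb; rewrite mulrC eb idealr1.
have /choice[z hz] (i : 'I_n) : exists z, forall u, col u = i ->
    phi 'X_u \in c 0%N \/ phi 'X_u = z.
  have [[u [cu hu]]|nu] := pselect (exists u, col u = i /\ phi 'X_u \notin c 0%N).
    exists (phi 'X_u) => w cw; have [<-|uw] := eqVneq u w; [by right|left].
    have : phi 'X_u * phi 'X_w \in c 0%N by rewrite phi_col ?cu ?cw ?idealr0.
    by rewrite prime_idealrM (negPf hu).
  by exists 0 => u cu; left; apply: contraT => hu; case: nu; exists u.
pose f : {rmorphism k -> L} := phi \o @mpolyC v k.
have red p : exists p', phi p - mmap f z p' \in c 0%N.
  elim/mpoly_ring_ind: p => [b|u|p p' [s hs] [s' hs']|p p' [s hs] [s' hs']].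
  - by exists b%:MP; rewrite mmapC subrr idealr0.
  - have [hu|hu] := hz _ _ (erefl (col u)).
      by exists 0; rewrite mmap0 subr0.
    by exists 'X_(col u); rewrite mmapX mmap1U hu subrr idealr0.
  - by exists (s + s'); rewrite !rmorphD opprD addrACA rpredD.
  - exists (s * s'); rewrite !rmorphM.
    have -> x x' y y' : x * x' - y * y' = x' * (x - y) + y * (x' - y') :> L by ring.
    by rewrite rpredD ?idealMr.
have /choice[q hq] j := red (a j).
have [Q Q0 eQ] := algebraic_dependence q (ltnSn n).
case/eqP: Q0; apply: (@prime_chain_no_relation k _ L f (fun j => mmap f z (q j)) c).
- by move=> i ltin; case: (hc i (leq_trans ltin ltnd)).
- move=> j; have [ain aout] := ha j; have ltj : (j.+1 <= d)%N by exact: leq_trans ltnd.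
  have h1 := c0 _ ltj _ (hq j); have h2 := c0 _ (ltnW ltj) _ (hq j).
  split; first by have := rpredB ain h1; rewrite opprB addrC subrK.
  by apply: contra aout => h; have := rpredD h2 h; rewrite subrK.
- by rewrite -mmap_comp eQ mmap0 idealr0.
Qed.

End KrullBound.

(** * Hilbert's basis theorem *)

Definition fin_gen (R : comNzRingType) := forall I : R -> Prop, is_ideal I ->
  exists2 s, {in s, forall x, I x} & forall x, I x -> gens (fun x => x = 0) s x.

Section Noetherian.

Lemma fin_gen_noetherian (R : comNzRingType) : fin_gen R -> noetherian R.
Proof.
move=> fgR I; have [|s sI Is] := fgR (fun x => x \in I).
  by split=> [|x y|a x]; [exact: idealr0|exact: rpredD|exact: idealMr].
exists s => x; apply/idP/idP => [/Is/gen_ideal_gens //|/gen_ideal_gens].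
apply: (gens_min (K := fun x => x \in I)) => // [|_ ->]; last exact: idealr0.
by split=> [|y z|a y]; [exact: idealr0|exact: rpredD|exact: idealMr].
Qed.

Lemma fin_gen_surj (S R : comNzRingType) (q : {rmorphism S -> R}) :
  (forall y, exists x, q x = y) -> fin_gen S -> fin_gen R.
Proof.
move=> qs fgS I [I0 ID IM].
have [|s sI Is] := fgS (fun x => I (q x)).
  split=> [|x y|a x]; first by rewrite rmorph0.
    by rewrite rmorphD; exact: ID.
  by rewrite rmorphM; exact: IM.
exists (map q s) => [_ /mapP[x xs ->]|y]; first exact: sI.
have [x <-] := qs y => /Is.
have iG := gens_is_ideal (map q s) (ideal_zero R); have [G0 GD GM] := iG.
apply: (gens_min (K := fun x => gens _ (map q s) (q x))) => [|_ ->|z zs].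
- split=> [|z t|a z]; first by rewrite rmorph0.
    by rewrite rmorphD; exact: GD.
  by rewrite rmorphM; exact: GM.
- by rewrite rmorph0.
- by apply: (mem_gens (ideal_zero R)); exact: map_f.
Qed.

Lemma fin_gen_field (k : fieldType) : fin_gen k.
Proof.
move=> I [I0 ID IM].
have [[x [Ix x0]]|h] := pselect (exists x, I x /\ x != 0).
  exists [:: 1] => [y|y _]; last by exists y; rewrite mulr1 subrr.
  by rewrite inE => /eqP ->; rewrite -(mulVf x0); exact: IM.
exists [::] => // x Ix; apply: contrapT => x0.
by apply: h; exists x; split=> //; exact/eqP.
Qed.

Variable R : comNzRingType.

(** A combination of leading coefficients is the coefficient of degree [m.-1] of
    the same combination of the polynomials, shifted to have that degree. *)
Lemma lift_lead_coef (l : seq {poly R}) m x :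
  {in l, forall h : {poly R}, (size h <= m)%N} ->
  gens (fun x => x = 0) (map lead_coef l) x ->
  exists p, [/\ gens (fun x => x = 0) l p, (size p <= m)%N & p`_m.-1 = x].
Proof.
move=> lm; have [G0 GD GM] := gens_is_ideal l (ideal_zero {poly R}).
pose K x := exists p, [/\ gens (fun x => x = 0) l p, (size p <= m)%N & p`_m.-1 = x].
have K0 : K 0 by exists 0; rewrite size_poly0 coef0.
apply: (@gens_min _ _ K) => [|_ -> //|_ /mapP[h hl ->]].
- split=> // [y z [p [hp sp <-]] [q [hq sq <-]]|a y [p [hp sp <-]]].
    exists (p + q); split; [exact: GD| |exact: coefD].
    by rewrite (leq_trans (size_polyD _ _)) // geq_max sp.
  exists (a%:P * p); split; [exact: GM| |exact: coefCM].
  by rewrite mul_polyC (leq_trans (size_scale_leq _ _)).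
- have [->|h0] := eqVneq h 0; first by rewrite lead_coef0.
  have sh0 : (0 < size h)%N by rewrite size_poly_gt0.
  have sh := lm _ hl.
  exists ('X^(m - size h) * h); split.
  + by apply: GM; exact: (mem_gens (ideal_zero _)).
  + rewrite (leq_trans (size_polyMleq _ _)) // size_polyXn addSn /= subnK //.
  + have e1 : (m - size h <= m.-1)%N by lia.
    have e2 : (m.-1 - (m - size h) = (size h).-1)%N by lia.
    by rewrite coefXnM ltnNge e1 /= e2.
Qed.

(** Otherwise choose [g n] of least degree in [I] outside the ideal of the
    previous ones.  The ideal of all leading coefficients is generated by finitely
    many, so the leading coefficient of some [g N] is a combination of the earlier
    ones, and cancelling it contradicts the choice of [g N]. *)
Lemma hilbert_basis : fin_gen R -> fin_gen {poly R}.
Proof.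
move=> fgR I iI; have [I0 ID IM] := iI; apply: contrapT => nfg.
pose Z := fun x : {poly R} => x = 0.
have /choice[step hstep] (l : seq {poly R}) : exists g, {in l, forall x, I x} ->
    [/\ I g, ~ gens Z l g & forall h, I h -> ~ gens Z l h -> (size g <= size h)%N].
  have [lI|nlI] := pselect {in l, forall x, I x}; last by exists 0.
  have [g [Ig ng]] : exists g, I g /\ ~ gens Z l g.
    apply: contrapT => h; apply: nfg; exists l => // x Ix.
    by apply: contrapT => nx; apply: h; exists x.
  have ex : exists n, `[< exists g, [/\ I g, ~ gens Z l g & size g = n] >].
    by exists (size g); apply/asboolP; exists g.
  case: (ex_minnP ex) => n /asboolP[g' [Ig' ng' <-]] minn.
  exists g' => _; split=> // h Ih nh; apply: minn; apply/asboolP; by exists h.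
pose l := fix l n := if n is n'.+1 then rcons (l n') (step (l n')) else [::].
pose g n := step (l n).
have lI n : {in l n, forall x, I x}.
  elim: n => // n IH x; rewrite /= mem_rcons inE => /predU1P[->|/IH //].
  by have [] := hstep _ IH.
have lS m n : (m <= n)%N -> {subset l m <= l n}.
  elim: n => [|n IH]; first by rewrite leqn0 => /eqP ->.
  rewrite leq_eqVlt => /predU1P[-> //|/IH sub] x /sub xl.
  by rewrite /= mem_rcons inE xl orbT.
have iZ := ideal_zero R; have iZ' : is_ideal Z := ideal_zero {poly R}.
pose G n := gens (fun x : R => x = 0) (map lead_coef (l n)).
have GS m n x : (m <= n)%N -> G m x -> G n x.
  move=> mn; apply: (gens_min (K := G n)).
  - exact: gens_is_ideal.
  - by move=> _ ->; case: (gens_is_ideal (map lead_coef (l n)) iZ).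
  - by move=> _ /mapP[h hl ->]; apply: mem_gens => //; apply/map_f/(lS m).
have [|t tG Gt] := fgR (fun x => exists n, G n x).
  split; first by exists 0%N.
  - move=> x y [m hm] [n hn]; exists (maxn m n).
    have [_ D _] := gens_is_ideal (map lead_coef (l (maxn m n))) iZ.
    by apply: D; [apply: GS hm|apply: GS hn]; rewrite ?leq_maxl ?leq_maxr.
  - move=> a x [n hn]; exists n.
    by have [_ _ M] := gens_is_ideal (map lead_coef (l n)) iZ; exact: M.
have [N hN] : exists N, {in t, forall x, G N x}.
  elim: t tG {Gt} => [|y t IH] tG; first by exists 0%N.
  have [|N hN] := IH; first by move=> x xt; apply: tG; rewrite inE xt orbT.
  have [m hm] := tG y (mem_head _ _); exists (maxn m N) => x.
  rewrite inE => /predU1P[->|/hN h]; [apply: GS hm|apply: GS h].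
    exact: leq_maxl.
  exact: leq_maxr.
have [Ig ng ming] := hstep _ (lI N).
have lead_in : G N (lead_coef (g N)).
  have : exists n, G n (lead_coef (g N)).
    exists N.+1; apply: mem_gens => //.
    by rewrite /= map_rcons mem_rcons mem_head.
  move/Gt; apply: (gens_min (K := G N)) => //; first exact: gens_is_ideal.
  by move=> _ ->; case: (gens_is_ideal (map lead_coef (l N)) iZ).
have lsize : {in l N, forall h : {poly R}, (size h <= size (g N))%N}.
  have h n : (n <= N)%N -> {in l n, forall h : {poly R}, (size h <= size (g N))%N}.
    elim: n => // n IH ltn x; rewrite /= mem_rcons inE => /predU1P[->|xl]; last exact: IH (ltnW ltn) _ xl.
    have [_ _ minn] := hstep _ (lI n); apply: minn => // gn; apply: ng.
    apply: (gens_min (K := gens Z (l N))) gn; first exact: gens_is_ideal.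
      by move=> _ ->; case: (gens_is_ideal (l N) iZ').
    by move=> y yl; apply: mem_gens => //; apply: lS yl; exact: ltnW.
  exact: h.
have [p [pG sp ep]] := lift_lead_coef lsize lead_in.
have Ip : I p by apply: (gens_min (K := I)) pG => // _ ->.
have np : ~ gens Z (l N) (g N - p).
  move=> h; apply: ng; have [_ D _] := gens_is_ideal (l N) iZ'.
  by have := D _ _ h pG; rewrite subrK.
have := ming _ (idealB iI Ig Ip) np; rewrite leqNgt => /negP; apply.
have g0 : (0 < size (g N))%N.
  rewrite size_poly_gt0; apply/eqP => g0; apply: ng; rewrite -/(g N) g0.
  by case: (gens_is_ideal (l N) iZ').
rewrite -[X in (_ < X)%N]prednK // ltnS; apply/leq_sizeP => j.
rewrite leq_eqVlt coefB => /predU1P[<-|]; first by rewrite ep subrr.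
by rewrite prednK // => hj; rewrite !nth_default ?subrr // (leq_trans sp).
Qed.

End Noetherian.

Lemma fin_gen_mpoly (k : fieldType) n : fin_gen {mpoly k[n]}.
Proof.
elim: n => [|n IH].
  apply: (@fin_gen_surj k _ (@mpolyC 0 k)) (@fin_gen_field k) => q.
  exists (q@_0); apply/mpolyP => m; rewrite mcoeffC.
  by have -> : m = 0%MM; [apply/mnmP; case|rewrite eqxx mulr1].
pose w : {rmorphism {mpoly k[n]} -> {mpoly k[n.+1]}} :=
  mmap (@mpolyC n.+1 k) ((fun j => 'X_j) \o lift ord0).
pose ev : {rmorphism {poly {mpoly k[n]}} -> {mpoly k[n.+1]}} :=
  horner_eval ('X_ord0) \o map_poly w.
apply: (@fin_gen_surj {poly {mpoly k[n]}} {mpoly k[n.+1]} ev) (hilbert_basis IH) => Q.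
by exists (mpop Q); rewrite -[RHS]mmap_id mmap_pop.
Qed.

(** * Monic polynomials in distinct variables *)

Section CoefficientExtraction.
Variables (k : fieldType) (N : nat).
Local Notation S := {mpoly k[N]}.
Implicit Types (J : S -> Prop) (i : 'I_N).

(** A polynomial seen as a polynomial in ['X_i], the other variables being moved
    to the coefficients. *)
Definition coef_in i : {rmorphism S -> {poly S}} :=
  mmap (polyC \o @mpolyC N k) (fun u => if u == i then 'X else ('X_u)%:P).

Lemma coef_inC i c : coef_in i c%:MP = c%:MP%:P.
Proof. exact: mmapC. Qed.

Lemma coef_inX i u : coef_in i 'X_u = if u == i then 'X else ('X_u)%:P.
Proof. by rewrite /coef_in /= mmapX mmap1U. Qed.

Lemma coef_inD i : {morph coef_in i : p q / p + q}.
Proof. exact: rmorphD. Qed.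

Lemma coef_inB i : {morph coef_in i : p q / p - q}.
Proof. exact: rmorphB. Qed.

Lemma coef_inM i : {morph coef_in i : p q / p * q}.
Proof. exact: rmorphM. Qed.

Lemma coef_inK i q : (coef_in i q).['X_i] = q.
Proof.
pose ev : {rmorphism S -> S} := horner_eval 'X_i \o coef_in i.
apply: (mpoly_rmorph_ext (f := ev) (g := idfun)) => [c|u] /=.
- by rewrite coef_inC /horner_eval hornerC.
- by rewrite coef_inX /horner_eval; case: eqP => [->|_]; rewrite ?hornerX ?hornerC.
Qed.

(** [J] is extended from an ideal of the polynomial ring without ['X_i]. *)
Definition coef_closed i J := forall q, J q -> forall j, J (coef_in i q)`_j.

Definition subst_poly (f : {poly k}) (x : S) : S := (map_poly (@mpolyC N k) f).[x].

Lemma subst_poly_congr J f x y : is_ideal J -> J (x - y) ->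
  J (subst_poly f x - subst_poly f y).
Proof.
move=> iJ Jxy; have [J0 JD JM] := iJ; rewrite /subst_poly.
elim/poly_ind: (map_poly _ f) => [|p c IH]; first by rewrite !horner0 subrr.
rewrite !hornerMXaddC.
have -> : p.[x] * x + c - (p.[y] * y + c) = p.[x] * (x - y) + y * (p.[x] - p.[y]) by ring.
by apply: JD; apply: JM.
Qed.

Lemma coef_in_subst i u f : coef_in i (subst_poly f 'X_u) =
  (map_poly polyC (map_poly (@mpolyC N k) f)).[if u == i then 'X else ('X_u)%:P].
Proof.
rewrite /subst_poly -horner_map /= coef_inX; congr (_.[_]).
by apply/polyP => j; rewrite !coef_map /= coef_inC.
Qed.

Lemma coef_in_subst_eq i f : coef_in i (subst_poly f 'X_i) = map_poly (@mpolyC N k) f.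
Proof. by rewrite coef_in_subst eqxx; exact: comp_polyXr. Qed.

Lemma coef_in_subst_neq i u f : u != i ->
  coef_in i (subst_poly f 'X_u) = (subst_poly f 'X_u)%:P.
Proof. by move=> ui; rewrite coef_in_subst (negPf ui) horner_map. Qed.

(** The leading coefficient of [b] is that of [p * b], so it lies in [J]; remove
    it and repeat. *)
Lemma monic_coef_ideal J (p b : {poly S}) : is_ideal J -> p \is monic ->
  (forall j, J (p * b)`_j) -> forall j, J b`_j.
Proof.
move=> iJ pm; have [J0 JD JM] := iJ.
have sp : (0 < size p)%N by rewrite size_poly_gt0 monic_neq0.
have [n] := ubnP (size b); elim: n b => // n IH b; rewrite ltnS => sb hpb.
pose b' := take_poly n.-1 b.
case: n IH sb @b' => [|n] IH sb b'.
  by move=> j; move: sb; rewrite leqn0 size_poly_eq0 => /eqP ->; rewrite coef0.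
have eb : b = b' + b`_n *: 'X^n.
  apply/polyP => j; rewrite coefD coef_take_poly coefZ coefXn.
  case: ltngtP => h; rewrite ?mulr0 ?addr0 ?mulr1 ?add0r ?h //.
  by rewrite nth_default // (leq_trans sb).
have sb' : (size b' <= n)%N by exact: size_take_poly.
have Jn : J b`_n.
  have low : (p * b')`_((size p).-1 + n) = 0.
    rewrite nth_default // (leq_trans (size_polyMleq _ _)) //.
    by rewrite -[X in (X + size b').-1]prednK // addSn leq_add2l.
  have := hpb ((size p).-1 + n)%N; rewrite {1}eb mulrDr coefD low add0r.
  by rewrite -scalerAr coefZ coefMXn ltnNge leq_addl /= addnK -lead_coefE (monicP pm) mulr1.
have {}IH : forall j, J b'`_j.
  apply: IH => [|j]; first by rewrite ltnS.
  have -> : (p * b')`_j = (p * b)`_j - b`_n * (p * 'X^n)`_j.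
    by rewrite {1}eb mulrDr coefD -scalerAr coefZ addrK.
  by apply: idealB => //; rewrite mulrC; apply: JM.
move=> j; rewrite eb coefD; apply: JD => //; rewrite coefZ mulrC; exact: JM.
Qed.

(** Modulo [J] the element is a monic polynomial in ['X_i] over a ring without
    ['X_i], so the preceding lemma applies. *)
Lemma nzd_subst J i f x : is_ideal J -> coef_closed i J -> J (x - 'X_i) ->
  f \is monic -> nzd J (subst_poly f x).
Proof.
move=> iJ cJ Jx fm a Ja; have [J0 JD JM] := iJ.
have {}Ja : J (subst_poly f 'X_i * a).
  have h := JM a _ (subst_poly_congr f iJ Jx).
  by have := idealB iJ Ja h; congr J; ring.
rewrite -(coef_inK i a) horner_coef; apply: ideal_sum => // j _.
rewrite mulrC; apply: JM.
apply: (monic_coef_ideal iJ (p := map_poly (@mpolyC N k) f)) => [|l].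
  exact: monic_map.
by rewrite -(coef_in_subst_eq i) -coef_inM; apply: cJ.
Qed.

Lemma coef_closed_adjoin J i u f x : is_ideal J -> J (x - 'X_u) -> u != i ->
  coef_closed i J -> coef_closed i (adjoin_ideal J (subst_poly f x)).
Proof.
move=> iJ Jx ui cJ q [c hc] j; have [J0 JD JM] := iJ.
pose F := subst_poly f x; pose F' := subst_poly f 'X_u.
have JF : J (F - F') by exact: subst_poly_congr.
have hc' : J (q - c * F').
  by have := JD _ _ hc (JM c _ JF); rewrite -/F; congr J; ring.
have swap a b : J (a - b * F') -> J (a - b * F).
  by move=> h; have := idealB iJ h (JM b _ JF); congr J; ring.
exists (coef_in i c)`_j; apply: swap; have := cJ _ hc' j.
by rewrite coef_inB coef_inM coef_in_subst_neq // coefB coefMC => h; exact: h.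
Qed.

Lemma weakly_regular_subst (T : eqType) (w : T -> 'I_N) (x : T -> S)
    (f : T -> {poly k}) (s : seq T) J :
  injective w -> is_ideal J -> (forall t, f t \is monic) ->
  (forall t, coef_closed (w t) J) -> (forall t, J (x t - 'X_(w t))) ->
  uniq s -> weakly_regular J [seq subst_poly (f t) (x t) | t <- s].
Proof.
move=> winj iJ fm cJ Jx us.
have {}cJ : {in s, forall t, coef_closed (w t) J} by move=> t _.
elim: s us J iJ cJ Jx => //= t s IH /andP[ts us] J iJ cJ Jx.
split; first by apply: nzd_subst (fm t) => //; apply: cJ; rewrite mem_head.
apply: IH => // [|u us' | u].
- exact: adjoin_is_ideal.
- apply: coef_closed_adjoin (Jx t) _ (cJ u _) => //; last by rewrite inE us' orbT.
  by apply: contraNneq ts => /winj ->.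
- exact/sub_adjoin/Jx.
Qed.

End CoefficientExtraction.

(** * Ideals of independence complexes *)

Section StanleyReisner.
Variables (k : fieldType) (V : finType) (G : simple_graph V).
Local Notation N := #|V|.
Local Notation S := {mpoly k[N]}.
Implicit Types (W : {set V}) (m : 'X_{1..N}) (q : S) (u v : V).
Local Notation X v := ('X_(enum_rank v) : S).

(** The support of the monomial is an independent set contained in [W]. *)
Definition face W m :=
  [forall v, (m (enum_rank v) != 0%N) ==> (v \in W)] &&
  [forall u, forall v, G u v ==> (m (enum_rank u) == 0%N) || (m (enum_rank v) == 0%N)].

(** The Stanley-Reisner ideal of the independent sets contained in [W], generated
    by the edges and by the variables outside [W]; describing it by monomials
    makes its colon ideals computable. *)
Definition stanley_reisner W q := forall m, m \in msupp q -> ~~ face W m.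

Lemma faceP W m : reflect
  ((forall v, m (enum_rank v) != 0%N -> v \in W) /\
   (forall u v, G u v -> m (enum_rank u) != 0%N -> m (enum_rank v) != 0%N -> False))
  (face W m).
Proof.
apply: (iffP andP) => -[h1 h2]; split.
- by move=> v; move/forallP: h1 => /(_ v)/implyP.
- move=> u v uv; move/forallP: h2 => /(_ u)/forallP/(_ v)/implyP/(_ uv).
  by case/orP => ->.
- by apply/forallP => v; apply/implyP/h1.
- apply/forallP => u; apply/forallP => v; apply/implyP => uv.
  by rewrite -[_ || _]negbK negb_or; apply/negP => /andP[]; exact: h2.
Qed.

Lemma face_sub W W' m : W \subset W' -> face W m -> face W' m.
Proof.
move=> /subsetP sW /faceP[h1 h2]; apply/faceP; split=> // v hv; exact/sW/h1.
Qed.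

Lemma face_addr W m m' : face W (m + m')%MM -> face W m'.
Proof.
move/faceP => [h1 h2]; apply/faceP; split=> [v hv|u v uv hu hv].
  by apply: h1; rewrite mnmDE addn_eq0 negb_and hv orbT.
by apply: (h2 u v uv); rewrite mnmDE addn_eq0 negb_and ?hu ?hv orbT.
Qed.

Lemma stanley_reisner_ideal W : is_ideal (stanley_reisner W).
Proof.
split=> [m|p q hp hq m|a q hq m]; first by rewrite msupp0.
  by move/msuppD_le; rewrite mem_cat => /orP[/hp|/hq].
by case/msuppM_le/allpairsP => -[m1 m2] [_ /hq h ->]; apply: contra h => /face_addr.
Qed.

Lemma stanley_reisner_monomial W c m : ~~ face W m -> stanley_reisner W (c *: 'X_[m]).
Proof. by move=> nf m' /msuppZ_le; rewrite msuppX inE => /eqP ->. Qed.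

Lemma stanley_reisner_var W v : v \notin W -> stanley_reisner W (X v).
Proof.
move=> vW; rewrite -[X v]scale1r; apply: stanley_reisner_monomial.
by apply: contra vW => /faceP[h _]; apply: h; rewrite mnm1E eqxx.
Qed.

Lemma mpolyX_factor m v : m (enum_rank v) != 0%N ->
  'X_[m] = X v * 'X_[m - U_(enum_rank v)] :> S.
Proof. by move=> mv; rewrite -mpolyXD addmC submK // lep1mP. Qed.

Definition nbrs v : {set V} := [set u | G v u].

Lemma mnmUD_neq0 m u v : ((U_(enum_rank v) + m)%MM (enum_rank u) != 0%N) =
  (u == v) || (m (enum_rank u) != 0%N).
Proof.
rewrite mnmDE mnm1E addn_eq0 negb_and (inj_eq enum_rank_inj) [v == u]eq_sym.
by case: (u == v).
Qed.

Lemma face_link W v m : v \in W ->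
  face W (U_(enum_rank v) + m)%MM = face (W :\: nbrs v) m.
Proof.
move=> vW; apply/faceP/faceP => -[h1 h2]; split.
- move=> u hu; rewrite !inE; apply/andP; split.
    by apply/negP => vu; apply: (h2 v u vu); rewrite mnmUD_neq0 ?eqxx ?hu ?orbT.
  by apply: h1; rewrite mnmUD_neq0 hu orbT.
- by move=> u u' uu' hu hu'; apply: (h2 u u' uu'); rewrite mnmUD_neq0 ?hu ?hu' orbT.
- move=> u; rewrite mnmUD_neq0 => /predU1P[-> //|/h1].
  by rewrite !inE => /andP[].
- move=> u u' uu'; rewrite !mnmUD_neq0 => /predU1P[eu|hu] /predU1P[eu'|hu'].
  + by rewrite eu eu' adj_irr in uu'.
  + by have := h1 _ hu'; rewrite !inE -eu uu'.
  + by have := h1 _ hu; rewrite !inE adj_sym -eu' adj_sym adj_sym uu'.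
  + exact: h2 uu' hu hu'.
Qed.

(** A monomial [x_v * m] is supported on a face of [W] exactly when [m] is
    supported on a face of [W] that avoids the neighbours of [v]. *)
Lemma stanley_reisner_colon W v : v \in W ->
  colon (stanley_reisner W) (X v) = stanley_reisner (W :\: nbrs v).
Proof.
move=> vW; apply/funext => q; apply/propext; rewrite /colon mulrC; split=> h m.
  move=> hm; rewrite -face_link //; apply: h.
  by rewrite (perm_mem (msuppMX _ _)) map_f.
rewrite (perm_mem (msuppMX _ _)) => /mapP[m' hm' ->]; rewrite face_link //.
exact: h.
Qed.

Lemma stanley_reisner_adjoin W v :
  adjoin_ideal (stanley_reisner W) (X v) = stanley_reisner (W :\ v).
Proof.
have [iW iV] := (stanley_reisner_ideal W, stanley_reisner_ideal (W :\ v)).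
apply/funext => q; apply/propext; split=> [[c hc]|hq].
  have [_ VD VM] := iV; rewrite -[q](subrK (c * X v)); apply: VD.
    by move=> m /hc; apply: contra; apply: face_sub; exact: subsetDl.
  by apply: VM; apply: stanley_reisner_var; rewrite !inE eqxx.
pose c := \sum_(m <- msupp q | m (enum_rank v) != 0%N) q@_m *: 'X_[m - U_(enum_rank v)] : S.
exists c.
have -> : q - c * X v = \sum_(m <- msupp q | m (enum_rank v) == 0%N) q@_m *: 'X_[m].
  have -> : c * X v = \sum_(m <- msupp q | m (enum_rank v) != 0%N) q@_m *: 'X_[m].
    rewrite mulr_suml; apply: eq_bigr => m hm.
    by rewrite (mpolyX_factor hm) -scalerAl mulrC.
  by rewrite {1}[q]mpolyE (bigID (fun m : 'X_{1..N} => m (enum_rank v) == 0%N)) /= addrK.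
rewrite big_seq_cond; apply: (ideal_sum _ iW) => m /andP[hm /eqP mv].
apply: stanley_reisner_monomial; apply: contra (hq _ hm) => /faceP[h1 h2].
apply/faceP; split=> // u hu; rewrite !inE (h1 u hu) andbT.
by apply: contraTneq hu => ->; rewrite mv.
Qed.

Lemma edge_idealE q : (q \in @edge_ideal k V G) <-> stanley_reisner setT q.
Proof.
have iT := stanley_reisner_ideal setT.
have [iE Egen Emin] := gen_idealP [pred q : vpoly k V |
    [exists x, exists y, G x y && (q == var k x * var k y)]].
split.
  apply: Emin => // p /existsP[x /existsP[y /andP[xy /eqP ->]]].
  rewrite /var -mpolyXD -[Z in stanley_reisner _ Z]scale1r.
  apply: stanley_reisner_monomial; apply/negP => /faceP[_ h].
  by apply: (h x y xy); rewrite mnmUD_neq0 ?eqxx // mnm1E eqxx orbT.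
move=> hq; rewrite [q]mpolyE big_seq.
apply: (ideal_sum _ iE) => m /hq nf; have [E0 ED EM] := iE.
have [x [y [xy mx my]]] : exists x y, [/\ G x y, m (enum_rank x) != 0%N & m (enum_rank y) != 0%N].
  apply: contrapT => h; case/negP: nf; apply/faceP; split=> // x y xy mx my.
  by apply: h; exists x, y.
rewrite (mpolyX_factor mx) (@mpolyX_factor _ y).
  rewrite mulrA mulrC scalerAl; apply: EM.
  by apply: Egen; apply/existsP; exists x; apply/existsP; exists y; rewrite xy /=.
rewrite mnmBE mnm1E (inj_eq enum_rank_inj).
have [exy|_] := eqVneq x y; first by rewrite exy adj_irr in xy.
by rewrite /= subn0.
Qed.

(** As [W] is independent, the ideal is generated by the variables outside [W],
    and ['X_v] is not one of them. *)
Lemma stanley_reisner_coef_closed W v : v \in W ->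
  (forall u u', u \in W -> u' \in W -> ~~ G u u') ->
  coef_closed (enum_rank v) (stanley_reisner W).
Proof.
move=> vW indW; have iW := stanley_reisner_ideal W; have [W0 WD WM] := iW.
pose K q := forall j, stanley_reisner W (coef_in k (enum_rank v) q)`_j.
have iK : is_ideal K.
  split.
  - by move=> j; rewrite raddf0 coef0.
  - by move=> p q hp hq j; rewrite coef_inD coefD; apply: WD; [exact: hp|exact: hq].
  - move=> a q hq j; rewrite coef_inM coefM; apply: (ideal_sum _ iW) => l _.
    by apply: WM; exact: hq.
have [K0 KD KM] := iK.
move=> q hq; change (K q); rewrite [q]mpolyE big_seq.
apply: (ideal_sum _ iK) => m /hq nf.
have [u [uW mu]] : exists u, u \notin W /\ m (enum_rank u) != 0%N.
  apply: contrapT => h; case/negP: nf; apply/faceP.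
  have mW u : m (enum_rank u) != 0%N -> u \in W.
    by move=> mu; apply: contraT => uW; case: h; exists u.
  split=> // x y xy /mW xW /mW yW; by case/negP: (indW x y xW yW).
rewrite (mpolyX_factor mu) -mul_mpolyC mulrCA mulrC; apply: KM => j.
rewrite coef_inX (inj_eq enum_rank_inj) ifN; last by apply: contraNneq uW => ->.
by rewrite coefC; case: ifP => // _; exact: stanley_reisner_var.
Qed.

Section Shedding.
Variables (n : nat) (col : V -> 'I_n).

(** A recursive certificate of Cohen-Macaulayness in the spirit of vertex
    decomposability.  In place of simplices, it ends with full transversals, on
    which one monic polynomial per colour is visibly a regular sequence; the
    variable [v] stays free in [W :\: nbrs v], as [v] is not its own neighbour. *)
Inductive sheddable : {set V} -> Prop :=
| SheddableTransversal (w : 'I_n -> V) :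
    (forall i, col (w i) = i) -> (forall i j, ~~ G (w i) (w j)) ->
    sheddable [set w i | i : 'I_n]
| SheddableVertex W v : v \in W -> sheddable (W :\ v) ->
    sheddable (W :\: nbrs v) -> sheddable W.

Definition color_sum (i : 'I_n) : S := \sum_(v | col v == i) X v.

(** At a transversal [w], all variables of colour [i] but [w i] vanish, so
    [color_sum i] is congruent to the variable of [w i]. *)
Lemma sheddable_regular W (f : 'I_n -> {poly k}) : sheddable W ->
  (forall i, f i \is monic) ->
  weakly_regular (stanley_reisner W) [seq subst_poly (f i) (color_sum i) | i <- enum 'I_n].
Proof.
move=> hW fm; elim: hW => [w colw indw|{}W v vW _ IHd _ IHl]; last first.
  apply: (weakly_regular_colon (x := X v)); first exact: stanley_reisner_ideal.
    by rewrite stanley_reisner_colon.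
  by rewrite stanley_reisner_adjoin.
set W0 := [set w i | i : 'I_n]; have iW := stanley_reisner_ideal W0.
apply: (@weakly_regular_subst k N _ (fun i => enum_rank (w i))) => //.
- by move=> i j /enum_rank_inj e; rewrite -(colw i) e colw.
- move=> i; apply: stanley_reisner_coef_closed; first exact: imset_f.
  by move=> _ _ /imsetP[j _ ->] /imsetP[l _ ->].
- move=> i; rewrite /color_sum (bigD1 (w i)) ?colw //= addrAC subrr add0r.
  apply: (ideal_sum _ iW) => v /andP[/eqP cv vw]; apply: stanley_reisner_var.
  by apply: contra vw => /imsetP[j _ ev]; rewrite -cv ev colw.
- exact: enum_uniq.
Qed.

End Shedding.

End StanleyReisner.

(** * Removing vertices from the top of the columns *)

(** [E a i b j] is the oriented edge from [(a, i)] to [(b, j)], from the lower to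
    the higher part. *)
Section IntervalShedding.
Variables (r n : nat) (G : simple_graph ('I_r * 'I_n)%type).
Variable E : nat -> 'I_n -> nat -> 'I_n -> bool.
Hypothesis adjE : forall x y, G x y = E x.1 x.2 y.1 y.2 || E y.1 y.2 x.1 x.2.
Hypothesis E_lt : forall b j h i, E b j h i -> (b < h)%N /\ (j <= i)%N.
Hypothesis E_column : forall b h i, (b < h < r)%N -> E b i h i.
Hypothesis E_down : forall b' b j h i, (b' <= b)%N -> (h < r)%N -> E b j h i -> E b' j h i.
Hypothesis E_comp : forall b j c i h i0, (h < r)%N ->
  E b j c.+1 i -> E c i h i0 -> E b j h i0.

Definition window (lo hi : 'I_n -> nat) : {set 'I_r * 'I_n} :=
  [set x : 'I_r * 'I_n | (lo x.2 <= x.1 <= hi x.2)%N].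

Lemma ltn_sum (f g : 'I_n -> nat) i0 : (forall i, f i <= g i)%N -> (f i0 < g i0)%N ->
  (\sum_i f i < \sum_i g i)%N.
Proof.
move=> le lt; rewrite (bigD1 i0) // [X in (_ < X)%N](bigD1 i0) //= -addSn.
by apply: leq_add => //; apply: leq_sum.
Qed.

(** The second hypothesis says that the bottom of each column receives no edge
    from the window; the third, that every column before one with several vertices
    still reaches the top part, which leaves room to raise its bottom.  With [v]
    the top of the last column having several vertices, the neighbours of [v] in
    the window lie below it, and in each column they form an initial segment of
    parts, of length [cnt]. *)
Lemma window_sheddable lo hi :
  (forall i, (lo i <= hi i < r)%N) ->
  (forall i j b, E b j (lo i) i -> (b < lo j)%N) ->
  (forall i j : 'I_n, (i < j)%N -> (lo j < hi j)%N -> hi i = r.-1) ->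
  sheddable G snd (window lo hi).
Proof.
have [m] := ubnP (\sum_i (hi i - lo i))%N.
elim: m lo hi => // m IH lo hi; rewrite ltnS => lem lohi bot top.
have lor i : (lo i < r)%N by have := lohi i; lia.
case: (pickP (fun i => lo i < hi i)%N) => [i1 hi1|tight]; last first.
  pose w i : 'I_r * 'I_n := (Ordinal (lor i), i).
  have -> : window lo hi = [set w i | i : 'I_n].
    apply/setP => -[a i]; rewrite inE /=; apply/idP/imsetP => [h|[j _ [-> ->]] /=].
      exists i => //; congr (_, _); apply/val_inj => /=.
      by have := tight i; have := lohi i; lia.
    by have := lohi j; lia.
  apply: SheddableTransversal => // i j; rewrite adjE /=.
  by apply/norP; split; apply/negP => /bot; rewrite ltnn.
have [i0 [hi0 maxi0]] : exists i0, (lo i0 < hi i0)%N /\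
    forall j, (lo j < hi j)%N -> (j <= i0)%N.
  case: (@arg_maxnP _ i1 (fun i => lo i < hi i)%N val hi1) => i0 h0 max0.
  by exists i0; split=> // j /max0.
have tight (j : 'I_n) : (i0 < j)%N -> lo j = hi j.
  by move=> lt; have := lohi j; have := maxi0 j; lia.
have hr : (hi i0 < r)%N by have := lohi i0; lia.
set h := hi i0 in hr *; pose v : 'I_r * 'I_n := (Ordinal hr, i0).
apply: (@SheddableVertex _ _ _ _ _ v).
- by rewrite inE /=; have := lohi i0; lia.
- pose hi' i := if i == i0 then h.-1 else hi i.
  have -> : window lo hi :\ v = window lo hi'.
    apply/setP => -[a i]; rewrite !inE /hi' /= xpair_eqE.
    have [->|_] := eqVneq i i0; last by rewrite andbF.
    by rewrite andbT -val_eqE /= /h; lia.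
  apply: IH => //.
  + apply: leq_trans lem; apply: (@ltn_sum _ _ i0) => [i|]; rewrite /hi' ?eqxx /h; last by lia.
    by case: eqP => [->|_]; lia.
  + by move=> i; rewrite /hi'; have := lohi i; case: eqP => [->|_]; rewrite /h; lia.
  + move=> i j lt; rewrite /hi' => lt'.
    have ltj : (lo j < hi j)%N by move: lt'; case: eqP => [->|_]; rewrite /h; lia.
    have -> : (i == i0) = false.
      by apply/eqP => e; have := maxi0 _ ltj; rewrite e in lt; lia.
    exact: top lt ltj.
- have ex j : exists b, ~~ E b j h i0.
    by exists h; apply/negP => /E_lt; lia.
  pose cnt j := ex_minn (ex j).
  have cntP b j : (b < cnt j)%N = E b j h i0.
    rewrite /cnt; case: ex_minnP => c Ec minc; apply/idP/idP => [lt|Eb].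
      by apply: contraLR lt => /minc; lia.
    by rewrite ltnNge; apply/negP => le; case/negP: Ec; exact: E_down le hr Eb.
  have cnt_le j : (cnt j <= h)%N.
    by rewrite leqNgt; apply/negP; rewrite cntP => /E_lt; lia.
  have cnt_big (j : 'I_n) : (i0 < j)%N -> cnt j = 0%N.
    move=> lt; case e: (cnt j) => [//|c]; have : (c < cnt j)%N by rewrite e.
    by rewrite cntP => /E_lt; lia.
  have cnt_i0 : cnt i0 = h.
    apply/eqP; rewrite eqn_leq cnt_le /=; case e: h => [//|c].
    by rewrite cntP E_column // e ltnSn -e.
  pose lo' j := maxn (lo j) (cnt j).
  have -> : window lo hi :\: nbrs G v = window lo' hi.
    apply/setP => -[a j]; rewrite !inE adjE /= /lo' geq_max.
    have -> : (cnt j <= a)%N = ~~ E a j h i0 by rewrite -cntP -leqNgt.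
    case: (boolP (lo j <= a <= hi j)%N) => [/andP[le1 le2]|nle]; last first.
      by rewrite andbF; apply/esym/negbTE; apply: contra nle => /andP[/andP[-> _] ->].
    rewrite le1 le2 !andbT /=; congr (~~ _); rewrite -[RHS]orFb; congr (_ || _).
    (* No edge leaves [v] inside the window: it would go to the only vertex of a
       later column, which is the bottom of that column. *)
    apply/negP => Ev; have [lt le] := E_lt Ev.
    have [eji|lti] : j = i0 \/ (i0 < j)%N.
      by move: le; rewrite leq_eqVlt => /predU1P[/val_inj ->|]; [left|right].
      by move: lt; rewrite eji in le2; lia.
    have : a = lo j :> nat by have := tight _ lti; lia.
    move=> ea; rewrite ea in Ev; have := bot _ _ _ Ev.
    by have := lohi i0; rewrite /h; lia.
  apply: IH.
  + apply: leq_trans lem; apply: (@ltn_sum _ _ i0) => [i|]; rewrite /lo'; first by lia.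
    by rewrite cnt_i0 /h; lia.
  + move=> i; rewrite /lo' geq_max; have := lohi i => /andP[-> ->].
    rewrite andbT /=; have [lt|gt|/val_inj ->] := ltngtP i i0.
    * by rewrite (top _ _ lt hi0); have := cnt_le i; lia.
    * by rewrite cnt_big.
    * by rewrite cnt_i0.
  + move=> i j b; rewrite /lo'; case: (leqP (cnt i) (lo i)) => [_ /bot|lt Eb]; first by lia.
    (* The bottom of column [i] has been raised to [c.+1] because [(c, i)] is a
       neighbour of [v]; composing the two edges makes [(b, j)] a neighbour. *)
    case e: (cnt i) lt Eb => [//|c] lt Eb.
    have Ec : E c i h i0 by rewrite -cntP e.
    have := E_comp hr Eb Ec; rewrite -cntP; lia.
  + by move=> i j lt lt'; apply: (top i j lt); move: lt'; rewrite /lo'; lia.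
Qed.

End IntervalShedding.

(** * Cohen-Macaulayness from shedding *)

Section MaximalIdeals.
Variables (R : comNzRingType) (p : prime_idealr R).

Lemma maximal_ideal_inv : maximal_ideal p ->
  forall x, x \notin p -> exists y, y * x - 1 \in p.
Proof.
move=> pmax x xp; apply: contrapT => h.
have ip : is_ideal (fun x => x \in p).
  by split=> [|y z|a y]; [exact: idealr0|exact: rpredD|exact: idealMr].
pose J : {pred R} := fun y => `[< adjoin_ideal (fun x => x \in p) x y >].
have [J0 JD JM] := adjoin_is_ideal x ip.
have Jc : idealr_closed J.
  split; first exact/asboolP.
    apply/asboolP => -[c hc]; apply: h; exists c.
    by rewrite -opprB rpredN.
  by move=> a y z /asboolP hy /asboolP hz; apply/asboolP/JD => //; exact: JM.
pose Ji := isIdealr.Build R J Jc.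
pose I : idealr R := HB.pack J Ji.
case/negP: xp; apply: (pmax I) => [y yp|]; first by apply/asboolP/sub_adjoin.
exact/asboolP/mem_adjoin.
Qed.

Lemma residue_field : maximal_ideal p -> exists (K : fieldType) (q : {rmorphism R -> K}),
  (forall y, exists x, q x = y) /\ (forall x, q x = 0 <-> x \in p).
Proof.
move=> pmax; pose T : comNzRingType := {ideal_quot p}.
pose q : {rmorphism R -> T} := \pi_{ideal_quot p}.
have q0 x : q x = 0 <-> x \in p.
  rewrite -[x in x \in p]subr0 Quotient.idealrBE -(rmorph0 q).
  by split=> [->|/eqP].
have qs y : exists x, q x = y by exists (repr y); rewrite /q /= reprK.
have /choice[inv hinv] (y : T) : exists z, if y == 0 then z = 0 else z * y = 1.
  case: eqP => [_|y0]; first by exists 0.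
  have [x ex] := qs y; have [z hz] : exists z, z * x - 1 \in p.
    by apply: (maximal_ideal_inv pmax); apply/negP => /q0; rewrite ex.
  exists (q z); apply/eqP; rewrite -subr_eq0 -ex -rmorphM -(rmorph1 q) -rmorphB.
  exact/eqP/q0.
have mulVf x : x != 0 -> inv x * x = 1.
  by have := hinv x; case: eqP.
have inv0 : inv 0 = 0 by have := hinv 0; rewrite eqxx.
pose F := GRing.ComNzRing_isField.Build T mulVf inv0.
pose K : fieldType := HB.pack T F.
by exists K, q.
Qed.

End MaximalIdeals.

Section ShellingImpliesCM.
Variables (k : fieldType) (V : finType) (G : simple_graph V).
Variables (n : nat) (col : V -> 'I_n).
Hypothesis col_clique : forall u v, u != v -> col u = col v -> G u v.
Hypothesis shed : sheddable G col setT.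

Local Notation S := {mpoly k[#|V|]}.
Local Notation A := (edge_ring k G).

Let proj : {rmorphism S -> A} := \pi_{ideal_quot (@edge_ideal k V G)}.

Lemma proj_surj y : exists x, proj x = y.
Proof. by exists (repr y); rewrite /proj /= reprK. Qed.

Lemma proj_eq0 x : proj x = 0 <-> stanley_reisner G setT x.
Proof.
rewrite -edge_idealE -[x in x \in _]subr0 Quotient.idealrBE -(rmorph0 proj).
by split=> [->|/eqP].
Qed.

Lemma color_sum_root (p : prime_idealr A) : maximal_ideal p ->
  exists f : 'I_n -> {poly k}, (forall i, f i \is monic) /\
    (forall i, proj (subst_poly (f i) (color_sum k col i)) \in p).
Proof.
move=> pmax; have [K [q [qs q0]]] := residue_field pmax.
pose phi : {rmorphism S -> K} := q \o proj.
have phis y : exists x, phi x = y.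
  by have [a <-] := qs y; have [x <-] := proj_surj a; exists x.
have /choice[f hf] i : exists f, f \is monic /\
    proj (subst_poly f (color_sum k col i)) \in p.
  have [f [f0 hf]] := zariski phis (phi (color_sum k col i)).
  exists ((lead_coef f)^-1 *: f); split.
    by rewrite monicE lead_coefZ mulVf ?lead_coef_eq0.
  apply/q0; rewrite /subst_poly -[LHS]/(phi _) -horner_map -map_poly_comp /=.
  by rewrite map_polyZ hornerZ hf mulr0.
by exists f; split=> i; case: (hf i).
Qed.

(** Both invariants of the local ring equal [n]: [bound] limits chains of primes
    by the number of colours, the sequence [s] attains it, and
    [regular_seq_chain] compares the two. *)
Lemma sheddable_CohenMacaulay : CohenMacaulay_graph k G.
Proof.
split; first exact: fin_gen_noetherian (fin_gen_surj proj_surj (@fin_gen_mpoly k _)).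
move=> p pmax; have loc := to_loc_localization p proj_surj.
set phi : {rmorphism _ -> _} := to_loc p \o proj in loc.
have [f [fm fp]] := color_sum_root pmax.
pose s := [seq subst_poly (f i) (color_sum k col i) | i <- enum 'I_n].
have kerE : (fun x => proj x = 0) = stanley_reisner G setT.
  by apply/funext => x; apply/propext; exact: proj_eq0.
have sreg : weakly_regular (fun x => proj x = 0) s.
  by rewrite kerE; exact: sheddable_regular.
have bound c d : @prime_chain (localization p) c d -> (d <= n)%N.
  apply: (@krull_bound k _ n _ phi (fun i => col (enum_val i))).
  - move=> y; have [a [d' [Dd e]]] := loc_frac loc y.
    have [b hb] := loc_unit loc Dd; exists a, d', b; split=> //.
    by rewrite mulrC.
  - move=> i j ij cij; rewrite -rmorphM.
    apply/(loc_ker loc); exists 1; first by rewrite rmorph1 idealr1.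
    rewrite mul1r; apply/proj_eq0/edge_idealE.
    have [_ Egen _] := gen_idealP [pred q : vpoly k V |
      [exists x, exists y, G x y && (q == var k x * var k y)]].
    apply: Egen; apply/existsP; exists (enum_val i); apply/existsP; exists (enum_val j).
    by rewrite col_clique //= ?(inj_eq enum_val_inj) // /var !enum_valK.
have [reg nu] : regular_seq (map phi s) /\ all [in @nonunits (localization p)] (map phi s).
  apply: (loc_regular_seq loc (M := fun x => proj x \in p)) => //.
  - split=> [|x y|a x]; first by rewrite rmorph0 idealr0.
      by rewrite rmorphD; exact: rpredD.
    by rewrite rmorphM; exact: idealMr.
  - by move=> x ->.
  - by move=> x ->; rewrite idealr0.
  - by move=> _ /mapP[i _ ->].
have size_s : size (map phi s) = n by rewrite size_map /s size_map size_enum_ord.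
exists n; split; split.
- by exists (map phi s).
- by move=> t /regular_seq_chain[c hc] _; exact: bound hc.
- by have [c hc] := regular_seq_chain reg; exists c; rewrite -size_s.
- exact: bound.
Qed.

End ShellingImpliesCM.

(** * The multipartite graph of composed partial orders *)

Local Close Scope quotient_scope.
Local Close Scope ring_scope.

Section Chains.
Variables (r n : nat) (P : finType) (p : 'I_n -> P) (le : nat -> nat -> rel P).
Hypothesis le_refl_antisym : forall a b : nat, (1 <= a)%N -> (a <= b)%N -> (b <= r - 1)%N ->
  reflexive (le a b) /\ antisymmetric (le a b).
Hypothesis le_partial_order : forall a : nat, (1 <= a)%N -> (a <= r - 1)%N ->
  [/\ reflexive (le a a), antisymmetric (le a a) & transitive (le a a)].
Hypothesis le_index : forall a b : nat, (1 <= a)%N -> (a <= b)%N -> (b <= r - 1)%N ->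
  forall i j : 'I_n, le a b (p i) (p j) -> (i <= j)%N.
Hypothesis le_comp : forall a b : nat, (1 <= a)%N -> (a <= b)%N -> (b <= r - 1)%N ->
  forall i j : 'I_n, le a b (p i) (p j) <->
    exists t : (b - a).-tuple 'I_n,
      sorted (fun u v : 'I_n => (u <= v)%N) t /\ le_chain p le a i t j.

Definition is_chain a b (g : nat -> 'I_n) :=
  forall l, (l <= b - a)%N -> le (a + l) (a + l) (p (g l)) (p (g l.+1)).

(** Sequences indexed by [nat], endpoints included, are easier to cut and splice
    than tuples; their monotonicity follows from [le_index]. *)
Lemma le_chainP a b i j : (1 <= a)%N -> (a <= b)%N -> (b <= r - 1)%N ->
  le a b (p i) (p j) <->
  exists g, [/\ g 0%N = i, g (b - a).+1 = j & is_chain a b g].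
Proof.
move=> a1 ab br; rewrite le_comp //; split=> [[t [_ ch]]|[g [g0 gl ch]]].
  exists (nth i (i :: rcons t j)); split=> //.
    by rewrite /= nth_rcons size_tuple ltnn eqxx.
  by move=> l ll; apply: ch; rewrite size_tuple.
have st : size (mkseq (fun l => g l.+1) (b - a)) == (b - a)%N by rewrite size_mkseq.
exists (Tuple st); split.
  apply/(sortedP i) => l; rewrite /= size_mkseq => ll.
  rewrite !nth_mkseq ?(ltnW ll) //; apply: (@le_index (a + l.+1) (a + l.+1)); try lia.
  by apply: ch; exact: ltnW.
have nthE l : (l <= (b - a).+1)%N -> nth i (i :: rcons (Tuple st) j) l = g l.
  case: l => [|l] //=; rewrite ltnS nth_rcons size_mkseq => ll.
  case: ltngtP ll => [lt|//|->]; first by rewrite nth_mkseq.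
  by rewrite gl.
move=> l; rewrite size_tuple => ll.
by rewrite (nthE l (leqW ll)) (nthE l.+1 ll); exact: ch.
Qed.

Definition arrow b (j : 'I_n) h (i : 'I_n) := [&& (b < h)%N, (h < r)%N & le b.+1 h (p j) (p i)].

Lemma arrow_lt b j h i : arrow b j h i -> (b < h)%N /\ (j <= i)%N.
Proof. by case/and3P => bh hr lee; split=> //; apply: le_index lee; lia. Qed.

Lemma arrow_column b h i : (b < h < r)%N -> arrow b i h i.
Proof.
move=> /andP[bh hr]; apply/and3P; split=> //.
by have [|||refl _] := @le_refl_antisym b.+1 h; [lia..|exact: refl].
Qed.

(** A chain is extended downwards by staying at its first element. *)
Lemma arrow_down b' b j h i : (b' <= b)%N -> (h < r)%N -> arrow b j h i -> arrow b' j h i.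
Proof.
move=> b'b hr /and3P[bh _ /le_chainP [|||g [g0 gl ch]]]; try lia.
apply/and3P; split=> //; first exact: leq_ltn_trans bh.
apply/le_chainP; try lia.
exists (fun l => g (l - (b - b'))%N); split; first by rewrite sub0n.
  by rewrite -gl; congr g; lia.
move=> l ll; have [lt|ge] := ltnP l (b - b').
  have -> : (l - (b - b') = 0)%N by lia.
  have -> : (l.+1 - (b - b') = 0)%N by lia.
  by have [|||refl _] := @le_refl_antisym (b'.+1 + l) (b'.+1 + l); [lia..|exact: refl].
have -> : (l.+1 - (b - b') = (l - (b - b')).+1)%N by lia.
have -> : (b'.+1 + l = b.+1 + (l - (b - b')))%N by lia.
by apply: ch; lia.
Qed.

(** The two chains overlap in the level [c.+1]: its last step in the first chain
    and its first step in the second are merged by transitivity. *)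
Lemma arrow_comp b j c i h i0 : (h < r)%N ->
  arrow b j c.+1 i -> arrow c i h i0 -> arrow b j h i0.
Proof.
move=> hr /and3P[bc cr /le_chainP [|||g [g0 gl ch]]]; try lia.
move=> /and3P[chh _ /le_chainP [|||g' [g'0 g'l ch']]]; try lia.
apply/and3P; split=> //; first by lia.
apply/le_chainP; try lia.
exists (fun l => if (l <= c - b)%N then g l else g' (l - (c - b))%N); split => //.
  rewrite ifF; last by lia.
  by rewrite -g'l; congr g'; lia.
move=> l ll; have [lt|gt|el] := ltngtP l (c - b)%N.
- by apply: ch; lia.
- have -> : (l.+1 - (c - b) = (l - (c - b)).+1)%N by lia.
  have -> : (b.+1 + l = c.+1 + (l - (c - b)))%N by lia.
  by apply: ch'; lia.
- have e1 : (b.+1 + l = c.+1)%N by lia.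
  have e2 : (l.+1 - (c - b) = 1)%N by lia.
  have e3 : (c.+1 - b.+1 = l)%N by lia.
  rewrite e1 e2.
  have [||_ _ tr] := @le_partial_order c.+1; try lia.
  apply: (tr (p i)).
    by have := ch l; rewrite e1 -{3}e3 gl; apply; lia.
  by have := ch' 0%N; rewrite g'0 addn0; apply.
Qed.

End Chains.

Theorem corollary4p6 (k : fieldType) (P : finType) (n r : nat)
    (p : 'I_n -> P) (p_bij : bijective p) (r_ge2 : (2 <= r)%N)
    (le : nat -> nat -> rel P)
    (le_refl_antisym : forall a b : nat, (1 <= a)%N -> (a <= b)%N -> (b <= r - 1)%N ->
       reflexive (le a b) /\ antisymmetric (le a b))
    (le_partial_order : forall a : nat, (1 <= a)%N -> (a <= r - 1)%N ->
       [/\ reflexive (le a a), antisymmetric (le a a) & transitive (le a a)])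
    (le_index : forall a b : nat, (1 <= a)%N -> (a <= b)%N -> (b <= r - 1)%N ->
       forall i j : 'I_n, le a b (p i) (p j) -> (i <= j)%N)
    (le_comp : forall a b : nat, (1 <= a)%N -> (a <= b)%N -> (b <= r - 1)%N ->
       forall i j : 'I_n,
         le a b (p i) (p j) <->
         exists t : (b - a).-tuple 'I_n,
           sorted (fun u v : 'I_n => (u <= v)%N) t /\ le_chain p le a i t j) :
  CohenMacaulay_graph k (rpartite_graph r p le).
Proof.
set G := rpartite_graph r p le.
have adjE x y : G x y = arrow r p le x.1 x.2 y.1 y.2 || arrow r p le y.1 y.2 x.1 x.2.
  by rewrite /arrow !ltn_ord.
apply: (@sheddable_CohenMacaulay k _ G n snd) => [[a i] [b j] neq eij|].
  rewrite /= in eij; rewrite adjE /= -eij; have [lt|gt|/val_inj eab] := ltngtP a b.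
  - by apply/orP; left; apply: arrow_column; rewrite ?lt ?ltn_ord.
  - by apply/orP; right; apply: arrow_column; rewrite ?gt ?ltn_ord.
  - by rewrite eab eij eqxx in neq.
have -> : setT = window r (fun _ : 'I_n => 0%N) (fun=> r.-1).
  by apply/setP => -[a i]; rewrite !inE /=; have := ltn_ord a; lia.
apply: (window_sheddable adjE).
- by move=> b j h i; exact: (arrow_lt le_index).
- by move=> b h i; exact: arrow_column.
- by move=> b' b j h i; exact: arrow_down.
- by move=> b j c i h i0; exact: arrow_comp.
- by move=> i; lia.
- by move=> i j b /(arrow_lt le_index)[].
- by [].
Qed.
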